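(* Let $d,m,p$ be positive integers and let $\mathbf{M}:\mathbb{Z}^d\to\mathbb{R}^{m\times p}$ satisfy $\sum_{\boldsymbol{\sigma}\in\mathbb{Z}^d}\|\mathbf{M}(\boldsymbol{\sigma})\|<\infty$. Let $\mathbf{e}=\{\mathbf{e}(\mathbf{t}),\,\mathbf{t}\in\mathbb{Z}^d\}$ be normalized $p$-dimensional white Gaussian noise and let $$\mathbf{y}(\mathbf{t})=\sum_{\boldsymbol{\sigma}\in\mathbb{Z}^d}\mathbf{M}(\boldsymbol{\sigma})\,\mathbf{e}(\mathbf{t}-\boldsymbol{\sigma}),\qquad \mathbf{t}\in\mathbb{Z}^d.$$ Let $\mathbf{R}_{\mathbf{k}}:=\mathbb{E}\,\mathbf{y}(\mathbf{t}+\mathbf{k})\mathbf{y}(\mathbf{t})^{\top}$ (independent of $\mathbf{t}$) and $\mathbf{\Phi}(e^{i\boldsymbol{\theta}}):=\sum_{\mathbf{k}\in\mathbb{Z}^d}\mathbf{R}_{\mathbf{k}}e^{-i\langle\mathbf{k},\boldsymbol{\theta}\rangle}$ for $\boldsymbol{\theta}\in\mathbb{T}^d:=[0,2\pi)^d$. Let $f:\mathbb{N}\to\mathbb{N}$ satisfy $\lim_{N\to\infty}f(N)=\infty$ and $\lim_{N\to\infty}f(N)^2/N=0$. For each $N$ set $n:=f(N)$, let $\Lambda_n:=\{\mathbf{k}\in\mathbb{Z}^d:|k_j|\le n\text{ for }j=1,\dots,d\}$, and define, from the observations $\{\mathbf{y}(\mathbf{t}):1\le t_j\le N,\ j=1,\dots,d\}$,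 the $f$-truncated periodogram $$\hat{\mathbf{\Phi}}(e^{i\boldsymbol{\theta}}):=\sum_{\mathbf{k}\in\Lambda_n}\hat{\mathbf{R}}_{\mathbf{k}}e^{-i\langle\mathbf{k},\boldsymbol{\theta}\rangle},\qquad \hat{\mathbf{R}}_{\mathbf{k}}:=\frac{1}{N_{\mathbf{k}}}\sum_{\mathbf{t}\in\Xi_{N,\mathbf{k}}}\mathbf{y}(\mathbf{t}+\mathbf{k})\mathbf{y}(\mathbf{t})^{\top}.$$ Then $\hat{\mathbf{\Phi}}$ is a uniformly mean-square consistent estimator of the spectral density, that is, with $\mathbf{\Delta}(e^{i\boldsymbol{\theta}}):=\mathbf{\Phi}(e^{i\boldsymbol{\theta}})-\hat{\mathbf{\Phi}}(e^{i\boldsymbol{\theta}})$, $$\lim_{N\to\infty}\mathbb{E}\,\|\mathbf{\Delta}(e^{i\boldsymbol{\theta}})\|^2=0\qquad\text{uniformly over }\boldsymbol{\theta}\in\mathbb{T}^d.$$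
   Context: $\|\cdot\|$ denotes the Frobenius norm of a matrix and $\langle\mathbf{k},\boldsymbol{\theta}\rangle:=k_1\theta_1+\dots+k_d\theta_d$. ''Normalized $p$-dimensional white Gaussian noise'' means that the $\mathbf{e}(\mathbf{t})$, $\mathbf{t}\in\mathbb{Z}^d$, are independent real Gaussian random vectors in $\mathbb{R}^p$ with zero mean and identity covariance matrix; the series defining $\mathbf{y}(\mathbf{t})$ converges in mean square. For $\mathbf{k}\in\mathbb{Z}^d$ with $|k_j|<N$ for all $j$, $\Xi_{N,\mathbf{k}}$ is the set of $\mathbf{t}\in\mathbb{Z}^d$ such that, for each $j=1,\dots,d$: $1\le t_j\le N-k_j$ if $k_j\ge0$, and $-k_j+1\le t_j\le N$ if $k_j<0$. Its cardinality is $N_{\mathbf{k}}:=|\Xi_{N,\mathbf{k}}|=(N-|k_1|)\cdots(N-|k_d|)$. The hypothesis $f(N)^2/N\to0$ ensures $n=f(N)<N$ for all sufficiently large $N$, and only such $N$ matter for the limit. *)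

(* Defs.v *)
From HB Require Import structures.
From mathcomp Require Import all_boot all_order all_algebra finmap.
From mathcomp Require Import all_classical all_reals all_analysis.
From mathcomp Require Import complex.
From mathcomp Require summability.

Set Implicit Arguments.
Unset Strict Implicit.
Unset Printing Implicit Defensive.

Import Order.TTheory GRing.Theory Num.Theory.
Import numFieldNormedType.Exports.

Local Open Scope classical_set_scope.
Local Open Scope ring_scope.

Definition Zlat (d : nat) := {ffun 'I_d -> int}.

(* <k, theta> *)
Definition pairing (R : realType) (d : nat) (k : Zlat d) (theta : 'I_d -> R) : R :=
  \sum_(j < d) (k j)%:~R * theta j.

(* e^{ix} for real x *)
Definition cis (R : realType) (x : R) : R[i] := (cos x +i* sin x)%C.

Definition torus (R : realType) (d : nat) : set ('I_d -> R) :=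
  [set theta | forall j, 0 <= theta j < 2 * pi].

Definition frobenius (R : realType) (a b : nat) (A : 'M[R]_(a, b)) : R :=
  Num.sqrt (\sum_(i < a) \sum_(j < b) `|A i j| ^+ 2).

(* [normc] is the real-valued complex modulus. *)
Definition cfrobenius (R : realType) (a b : nat) (A : 'M[R[i]]_(a, b)) : R :=
  Num.sqrt (\sum_(i < a) \sum_(j < b) ComplexField.Normc.normc (A i j) ^+ 2).

Definition outer (T : Type) (R : realType) (d m : nat)
    (y : Zlat d -> T -> 'cV[R]_m) (k t : Zlat d) (w : T) : 'M[R]_m :=
  y (t + k) w *m (y t w)^T.

Section random_vectors.
Context (disp : measure_display) (T : measurableType disp) (R : realType).
Context (P : probability T R).

Definition random_vector (a : nat) (X : T -> 'cV[R]_a) : Prop :=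
  forall i, measurable_fun [set: T] (fun w => X w i 0).

(* The sigma-algebra generated by the random vector X. *)
Definition sigma_vector (a : nat) (X : T -> 'cV[R]_a) : set (set T) :=
  <<s [set A | exists i, exists2 B : set R,
         measurable B & A = (fun w => X w i 0) @^-1` B] >>.

Definition independent_vectors (I : choiceType) (a : nat)
    (X : I -> T -> 'cV[R]_a) : Prop :=
  forall (J : {fset I}) (A : I -> set T),
    (forall t, t \in J -> sigma_vector (X t) (A t)) ->
    P (\bigcap_(t in [set` J]) A t) = (\prod_(t <- J) P (A t))%E.

(* N(mu, s^2), including the degenerate case: [normal_prob mu 0] is not the
   Dirac mass at mu. *)
Definition normal_law (mu s : R) (B : set R) : \bar R :=
  if s == 0 then (\d_mu B)%E else normal_prob mu s B.

Definition gaussian_vector (a : nat) (X : T -> 'cV[R]_a) : Prop :=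
  random_vector X /\
  forall u : 'cV[R]_a, exists mu s : R, forall B : set R, measurable B ->
    P ((fun w => (u^T *m X w) 0 0) @^-1` B) = normal_law mu s B.

Definition white_gaussian_noise (d p : nat) (e : Zlat d -> T -> 'cV[R]_p) : Prop :=
  [/\ forall t, gaussian_vector (e t),
      independent_vectors e,
      forall t i, ('E_P[fun w => e t w i ord0] = 0)%E &
      forall t i j, covariance P (fun w => e t w i 0) (fun w => e t w j 0)
                    = ((i == j)%:R)%:E].

(* The random field y is a version of the mean-square limit of
   sum_sigma M(sigma) e(t - sigma), along the finite subsets of Z^d ordered by
   inclusion. *)
Definition moving_average (d m p : nat) (M : Zlat d -> 'M[R]_(m, p))
    (e : Zlat d -> T -> 'cV[R]_p) (y : Zlat d -> T -> 'cV[R]_m) : Prop :=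
  forall t, random_vector (y t) /\
    (fun A : {fset Zlat d} =>
       ('E_P[fun w => (frobenius
         (y t w - summability.partial_sum (fun s => M s *m e (t - s) w) A)
           ^+ 2)%R])%E)
      @ summability.totally --> 0%E.

(* R_k := E y(t+k) y(t)^T does not depend on t; t = 0 is the reference point. *)
Definition autocov (d m : nat) (y : Zlat d -> T -> 'cV[R]_m) (k : Zlat d)
    : 'M[R]_m :=
  \matrix_(i, j) fine ('E_P[fun w => outer y k 0%R w i j])%E.

(* Entrywise unconditional sum over Z^d. *)
Definition spectral_density (d m : nat) (y : Zlat d -> T -> 'cV[R]_m)
    (theta : 'I_d -> R) : 'M[R[i]]_m :=
  \matrix_(i, j) @summability.sum (Zlat d) R[i] R[i]^o
    (fun k => (autocov y k i j)%:C%C * cis (- pairing k theta)).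

End random_vectors.

Definition Xi (d N : nat) (k : Zlat d) : set (Zlat d) :=
  [set t | forall j, if 0 <= k j then 1 <= t j <= N%:Z - k j
                     else - k j + 1 <= t j <= N%:Z].

Definition Lambda (d n : nat) : set (Zlat d) :=
  [set k | forall j, `|k j| <= n%:Z].

Section estimator.
Context (T : Type) (R : realType) (d m : nat) (y : Zlat d -> T -> 'cV[R]_m).

Definition autocov_est (N : nat) (k : Zlat d) (w : T) : 'M[R]_m :=
  (#|` fset_set (Xi N k)|%:R)^-1 *: \sum_(t \in Xi N k) outer y k t w.

Definition truncated_periodogram (N n : nat) (theta : 'I_d -> R) (w : T)
    : 'M[R[i]]_m :=
  \sum_(k \in Lambda n)
    cis (- pairing k theta) *: map_mx (real_complex R) (autocov_est N k w).

End estimator.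

(* Main.v *)
Require Import Defs.
From HB Require Import structures.
From mathcomp Require Import all_boot all_order all_algebra finmap.
From mathcomp Require Import all_classical all_reals all_analysis.
From mathcomp Require Import complex.
From mathcomp Require summability.
From mathcomp Require Import measurable_realfun random_variable.
From mathcomp Require Import normal_distribution.
From mathcomp Require Import zify ring lra.

(* Since R^_k is unbiased, Delta splits into the deterministic tail of the
   absolutely convergent series of the R_k, which is small uniformly in theta,
   and the sum over k in Lambda_n of (R_k - R^_k) e^{-i<k,theta>}; by
   Cauchy-Schwarz the mean square of the latter is at most |Lambda_n|^2 times the
   largest variance of the R^_k.  Everything rests on Var R^_k <= C / N_k with C
   independent of k.  Replacing y by a finite sum and expanding, R^_k - R_k becomes
   a combination, with coefficients M(sigma) M(tau), of the sums over t of
     W_t = e_a(t + u) e_b(t + v) - E e_a(t + u) e_b(t + v).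
   For fixed u, v, a, b the W_t are pairwise orthogonal: among t + u, t + v,
   s + u, s + v one index differs from the other three unless u = v, in which case
   W_t and W_s are independent.  Hence the sum over t has mean square at most N_k sup E W_t^2, and the triangle inequality
   in L^2 with the absolutely summable coefficients preserves this bound, which
   then passes to the limit since the products y(t+k) y(t)^T converge in L^1.
   Thus E |Delta|^2 is at most of order o(1) + ((2n + 1)^2 / (N - n))^d. *)

Set Implicit Arguments.
Unset Strict Implicit.
Unset Printing Implicit Defensive.

Import Order.TTheory GRing.Theory Num.Theory.
Import numFieldNormedType.Exports.

Local Open Scope classical_set_scope.
Local Open Scope ring_scope.

#[local] Existing Instance summability.totally_filter.

(** * Square integrable random variables *)

Section square_integrable.
Context (disp : measure_display) (T : measurableType disp) (R : realType).
Context (P : probability T R).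
Implicit Types X Y Z : T -> R.

Definition sqint X :=
  measurable_fun setT X /\ P.-integrable setT (EFin \o (fun w => X w ^+ 2)).

Lemma integrable_le X Y : measurable_fun setT X ->
  P.-integrable setT (EFin \o Y) -> (forall w, `|X w| <= Y w) ->
  P.-integrable setT (EFin \o X).
Proof.
move=> mX iY XY; apply: (le_integrable measurableT _ _ iY).
  exact/measurable_EFinP.
by move=> w _ /=; rewrite lee_fin (le_trans (XY w))// ler_norm.
Qed.

Lemma integrable_measurable_fun X : P.-integrable setT (EFin \o X) -> measurable_fun setT X.
Proof. by move=> /measurable_int/measurable_EFinP. Qed.

Lemma integrableD_EFin X Y : P.-integrable setT (EFin \o X) ->
  P.-integrable setT (EFin \o Y) ->
  P.-integrable setT (EFin \o (fun w => X w + Y w)).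
Proof. by move=> iX iY; exact: (integrableD measurableT iX iY). Qed.

Lemma integrableZ_EFin (c : R) X : P.-integrable setT (EFin \o X) ->
  P.-integrable setT (EFin \o (fun w => c * X w)).
Proof. by move=> iX; exact: (integrableZl measurableT c iX). Qed.

Lemma integrable_cst_EFin (c : R) : P.-integrable setT (EFin \o (fun _ => c)).
Proof. exact: finite_measure_integrable_cst. Qed.

Lemma Rintegral_prob_cst (c : R) : \int[P]_w c = c.
Proof. by rewrite Rintegral_cst// [fine _](_ : _ = 1) ?mulr1//= probability_setT. Qed.

Lemma integrable_sum_EFin (I : Type) (s : seq I) (F : I -> T -> R) :
  (forall i, P.-integrable setT (EFin \o F i)) ->
  P.-integrable setT (EFin \o (fun w => \sum_(i <- s) F i w)).
Proof.
move=> iF; elim: s => [|i s ih].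
  by apply: eq_integrable (integrable_cst_EFin 0) => // w _ /=; rewrite big_nil.
apply: eq_integrable (integrableD_EFin (iF i) ih) => // w _ /=.
by rewrite big_cons.
Qed.

Lemma Rintegral_sum (I : Type) (s : seq I) (F : I -> T -> R) :
  (forall i, P.-integrable setT (EFin \o F i)) ->
  (\int[P]_w (\sum_(i <- s) F i w) = \sum_(i <- s) \int[P]_w F i w)%R.
Proof.
move=> iF; elim: s => [|i s ih].
  rewrite big_nil; under eq_Rintegral do rewrite big_nil.
  exact: Rintegral_prob_cst.
under eq_Rintegral do rewrite big_cons.
by rewrite RintegralD// ?ih ?big_cons//; exact: integrable_sum_EFin.
Qed.

Lemma expectation_Rintegral X : P.-integrable setT (EFin \o X) ->
  ('E_P[X] = (\int[P]_w X w)%:E)%E.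
Proof. by move=> iX; rewrite unlock /Rintegral fineK// integrable_fin_num. Qed.

Lemma sqint_le X Y : measurable_fun setT X -> sqint Y ->
  (forall w, `|X w| <= `|Y w|) -> sqint X.
Proof.
move=> mX [mY iY] XY; split=> //; apply: (integrable_le _ iY).
  exact: measurable_funX.
by move=> w; rewrite normrX -[leRHS]ger0_norm ?sqr_ge0// normrX ler_pXn2r ?nnegrE.
Qed.

(** The product is dominated by [X^2 + Y^2]. *)
Lemma sqintM X Y : sqint X -> sqint Y ->
  P.-integrable setT (EFin \o (fun w => X w * Y w)).
Proof.
move=> [mX iX] [mY iY]; apply: (integrable_le _ (integrableD_EFin iX iY)).
  exact: measurable_funM.
move=> w /=; rewrite normrM -(real_normK (num_real (X w))).
rewrite -(real_normK (num_real (Y w))).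
have := sqr_ge0 (`|X w| - `|Y w|).
have : 0 <= `|X w| * `|Y w| by rewrite mulr_ge0.
by move: `|X w| `|Y w| => a b; lra.
Qed.

Lemma sqintD X Y : sqint X -> sqint Y -> sqint (fun w => X w + Y w).
Proof.
move=> sX sY; have [mX iX] := sX; have [mY iY] := sY; split.
  exact: measurable_funD.
have := integrableD_EFin (integrableD_EFin iX iY) (integrableZ_EFin 2 (sqintM sX sY)).
by apply: eq_integrable => // w _ /=; congr EFin; ring.
Qed.

Lemma sqintZ (c : R) X : sqint X -> sqint (fun w => c * X w).
Proof.
move=> [mX iX]; split; first exact: measurable_funM.
have := integrableZ_EFin (c ^+ 2) iX.
by apply: eq_integrable => // w _ /=; congr EFin; ring.
Qed.

Lemma sqint_cst (c : R) : sqint (fun _ => c).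
Proof. by split=> //; exact: integrable_cst_EFin. Qed.

Lemma sqintB X Y : sqint X -> sqint Y -> sqint (fun w => X w - Y w).
Proof.
move=> sX /(sqintZ (-1)) sY; have := sqintD sX sY.
by congr sqint; apply/funext => w; rewrite mulN1r.
Qed.

Lemma sqint_sum (I : Type) (s : seq I) (F : I -> T -> R) :
  (forall i, sqint (F i)) -> sqint (fun w => \sum_(i <- s) F i w).
Proof.
move=> sF; elim: s => [|i s ih].
  by under eq_fun do rewrite big_nil; exact: sqint_cst.
by under eq_fun do rewrite big_cons; exact: sqintD.
Qed.

Lemma sqint_integrable X : sqint X -> P.-integrable setT (EFin \o X).
Proof.
move=> /sqintM/(_ (sqint_cst 1)); apply: eq_integrable => // w _ /=.
by rewrite mulr1.
Qed.

(** Cauchy-Schwarz for the weights [|c i|], by induction on [s]. The inductive step carries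
    [b^2 <= a * q] for the sum [b] already treated, and absorbs the cross term [2 y b] into
    [a y^2 + q]. *)
Lemma wsum_sqr_le (I : Type) (s : seq I) (c v : I -> R) :
  (\sum_(i <- s) c i * v i) ^+ 2 <=
  (\sum_(i <- s) `|c i|) * (\sum_(i <- s) `|c i| * v i ^+ 2).
Proof.
have step (x y a b q : R) : 0 <= a -> 0 <= q -> b ^+ 2 <= a * q ->
    (x * y + b) ^+ 2 <= (`|x| + a) * (`|x| * y ^+ 2 + q).
  move=> a0 q0 baq.
  (* Compare squares: [4 y^2 b^2 <= 4 (a y^2) q <= (a y^2 + q)^2]. *)
  have h : `|2 * (y * b)| <= a * y ^+ 2 + q.
    rewrite -ler_sqr ?nnegrE ?addr_ge0 ?(mulr_ge0 a0) ?sqr_ge0//.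
    rewrite real_normK ?num_real//.
    have : y ^+ 2 * b ^+ 2 <= y ^+ 2 * (a * q) by rewrite ler_wpM2l// sqr_ge0.
    have := sqr_ge0 (a * y ^+ 2 - q); lra.
  have : x * (2 * (y * b)) <= `|x| * (a * y ^+ 2 + q).
    by rewrite (le_trans (ler_norm _))// normrM ler_wpM2l.
  have : `|x| * `|x| * y ^+ 2 = x * x * y ^+ 2.
    by rewrite -!expr2 real_normK ?num_real.
  by move: `|x| => z; lra.
elim: s => [|i s ih]; first by rewrite !big_nil expr0n mul0r.
rewrite !big_cons; apply: step => //; first exact: sumr_ge0.
by apply: sumr_ge0 => j _; rewrite mulr_ge0 ?sqr_ge0.
Qed.

(** The triangle inequality in L^2, squared: the pointwise weighted Cauchy-Schwarz inequality is
    integrated. The bound sees [s] only through the sum of the [|c i|]. *)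
Lemma wsum_sqint_le (I : eqType) (s : seq I) (c : I -> R) (V : I -> T -> R) (B : R) :
  (forall i, sqint (V i)) -> (forall i, i \in s -> \int[P]_w (V i w) ^+ 2 <= B) ->
  \int[P]_w (\sum_(i <- s) c i * V i w) ^+ 2 <= (\sum_(i <- s) `|c i|) ^+ 2 * B.
Proof.
move=> sV VB.
have iV i : P.-integrable setT (EFin \o (fun w => `|c i| * V i w ^+ 2)).
  by apply: integrableZ_EFin; case: (sV i).
apply: (@le_trans _ _ (\int[P]_w
    ((\sum_(i <- s) `|c i|) * (\sum_(i <- s) `|c i| * V i w ^+ 2)))).
  apply: le_Rintegral => //.
  - by case: (@sqint_sum _ s (fun i w => c i * V i w)) => // i; exact: sqintZ.
  - by apply: integrableZ_EFin; exact: integrable_sum_EFin.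
  - by move=> w _; exact: wsum_sqr_le.
rewrite RintegralZl//; last exact: integrable_sum_EFin.
rewrite expr2 -mulrA ler_wpM2l ?sumr_ge0//.
rewrite Rintegral_sum// mulr_suml big_seq [leRHS]big_seq; apply: ler_sum => i iS.
by rewrite RintegralZl// ?ler_wpM2l ?VB//; case: (sV i).
Qed.

(** Pythagoras: the cross term between the head and the remaining sum vanishes because the head does
    not recur in [s]. The bound is therefore linear in the number of terms, which is what gives the
    factor 1/N_k in the variance. *)
Lemma orthogonal_sum_sqint (I : eqType) (s : seq I) (W : I -> T -> R) (B : R) :
  uniq s -> (forall i, sqint (W i)) -> (forall i, \int[P]_w (W i w) ^+ 2 <= B) ->
  (forall i j, i != j -> \int[P]_w (W i w * W j w) = 0) ->
  \int[P]_w (\sum_(i <- s) W i w) ^+ 2 <= (size s)%:R * B.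
Proof.
move=> + sW WB W0; elim: s => [_|i s ih /= /andP[nis us]].
  under eq_Rintegral do rewrite big_nil expr0n/=.
  by rewrite Rintegral_prob_cst mul0r.
have sS := @sqint_sum _ s W sW.
have iM := sqintM (sW i) sS.
have [_ iW] := sW i; have [_ iS] := sS.
under eq_Rintegral => w _.
  rewrite big_cons (_ : (_ + _) ^+ 2 = W i w ^+ 2 + (\sum_(j <- s) W j w) ^+ 2 +
    2 * (W i w * (\sum_(j <- s) W j w))); last by ring.
  over.
rewrite RintegralD//; [|exact: integrableD_EFin|exact: integrableZ_EFin].
rewrite RintegralD// RintegralZl// [X in _ + 2 * X](_ : _ = 0); last first.
  under eq_Rintegral do rewrite mulr_sumr.
  rewrite Rintegral_sum; last by move=> j; exact: sqintM.
  rewrite big_seq big1// => j js; apply: W0.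
  by apply: contra nis => /eqP ->.
by rewrite mulr0 addr0 -natr1 mulrDl mul1r addrC lerD// ih.
Qed.

(* Truncation: F = min(|Z|, n) satisfies F^2 <= X^2 + 2 n |Z - X|. *)
Lemma sqint_L1_limit Z (B : R) : measurable_fun setT Z ->
  (forall eta : R, 0 < eta -> exists2 X, sqint X &
     \int[P]_w (X w) ^+ 2 <= B /\
     (\int[P]_w (`|Z w - X w|)%:E <= eta%:E)%E) ->
  sqint Z /\ \int[P]_w (Z w) ^+ 2 <= B.
Proof.
move=> mZ ZX.
pose F (n : nat) w := Num.min `|Z w| n%:R.
have mF n : measurable_fun setT (F n).
  by apply: measurable_minr => //; exact: measurableT_comp.
have F0 n w : 0 <= F n w by rewrite /F le_min normr_ge0 ler0n.
have FZ n w : F n w <= `|Z w| by rewrite /F ge_min lexx.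
have Fn n w : F n w <= n%:R by rewrite /F ge_min lexx orbT.
have FB n : (\int[P]_w ((F n w) ^+ 2)%:E <= B%:E)%E.
  have sF : sqint (F n).
    by apply: (sqint_le _ (sqint_cst n%:R)) => // w; rewrite !ger0_norm.
  have iF : P.-integrable setT (EFin \o (fun w => F n w ^+ 2)) by case: sF.
  suff : \int[P]_w (F n w) ^+ 2 <= B.
    by rewrite -lee_fin /Rintegral fineK// integrable_fin_num.
  apply/ler_addgt0Pr => eta eta0.
  (* The L^1 error gets multiplied by at most [2 (n + 1)] below; the successor keeps the denominator
     positive at [n = 0]. *)
  have k0 : 0 < eta / (2 * n.+1%:R) by rewrite divr_gt0// mulr_gt0.
  have [X sX [XB XZ]] := ZX _ k0.
  have [mX iX] := sX.
  have iZX : P.-integrable setT (EFin \o (fun w => `|Z w - X w|)).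
    apply/integrableP; split.
      by apply/measurable_EFinP/measurableT_comp => //; exact: measurable_funB.
    apply: le_lt_trans (ltry (eta / (2 * n.+1%:R))).
    by under eq_integral do rewrite /= normr_id.
  apply: (@le_trans _ _ (\int[P]_w (X w ^+ 2 + 2 * n.+1%:R * `|Z w - X w|))).
    apply: le_Rintegral => //.
      by apply: integrableD_EFin => //; exact: integrableZ_EFin.
    move=> w _.
    have h1 : F n w ^+ 2 <= F n w * `|X w| + F n w * `|Z w - X w|.
      rewrite expr2 -mulrDr ler_wpM2l// (le_trans (FZ n w))//.
      by rewrite -{1}(subrK (X w) (Z w)) addrC ler_normD.
    have h2 : F n w * `|Z w - X w| <= n.+1%:R * `|Z w - X w|.
      by rewrite ler_wpM2r// (le_trans (Fn n w))// ler_nat.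
    have := sqr_ge0 (F n w - `|X w|).
    by rewrite -(real_normK (num_real (X w))); lra.
  rewrite RintegralD//; last exact: integrableZ_EFin.
  rewrite RintegralZl// lerD//.
  rewrite mulrC -ler_pdivlMr ?mulr_gt0//.
  by rewrite -lee_fin /Rintegral fineK// integrable_fin_num.
have cvgF : (\int[P]_w ((F n w) ^+ 2)%:E @[n --> \oo] -->
             \int[P]_w ((Z w) ^+ 2)%:E)%E.
  rewrite [X in _ --> X](_ : _ = (\int[P]_w
      (limn (fun n => ((F n w) ^+ 2)%:E)))%E).
    apply: cvg_monotone_convergence => //.
    - by move=> n; apply/measurable_EFinP; exact: measurable_funX.
    - by move=> n w _; rewrite lee_fin sqr_ge0.
    - move=> w _ a b ab; rewrite lee_fin ler_pXn2r ?nnegrE//.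
      rewrite /F le_min ge_min lexx/= ge_min orbC.
      by rewrite (_ : a%:R <= b%:R)// ler_nat.
  apply: eq_integral => w _; apply/esym/cvg_lim => //.
  apply: cvg_near_cst.
  near=> n.
  rewrite /F min_l; first by rewrite real_normK// num_real.
  near: n; exact: nbhs_infty_ger.
have ZB : (\int[P]_w ((Z w) ^+ 2)%:E <= B%:E)%E.
  rewrite -(cvg_lim _ cvgF)//; apply: lime_le; first by apply/cvg_ex; eexists; exact: cvgF.
  by apply: nearW.
have iZ : P.-integrable setT (EFin \o (fun w => Z w ^+ 2)).
  apply/integrableP; split.
    by apply/measurable_EFinP; exact: measurable_funX.
  apply: le_lt_trans (ltry B).
  by under eq_integral do rewrite /= ger0_norm ?sqr_ge0//.
by split=> //; rewrite -lee_fin /Rintegral fineK// integrable_fin_num.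
Unshelve. all: by end_near. Qed.

End square_integrable.

(** * Fourth moments of Gaussian variables *)

Section normal_moments.
Context (R : realType).
Implicit Types mu s x : R.

(** The Radon-Nikodym derivative of [normal_prob] agrees almost everywhere with [normal_pdf], since
    both have the same integral over every measurable set. *)
Lemma ge0_integral_normal_prob mu s (f : R -> \bar R) :
  (forall x, 0 <= f x)%E -> measurable_fun setT f ->
  (\int[normal_prob mu s]_x f x =
   \int[lebesgue_measure]_x (f x * (normal_pdf mu s x)%:E))%E.
Proof.
move=> f0 mf.
have dom := normal_prob_dominates mu s.
rewrite -(Radon_Nikodym_SigmaFinite.change_of_variables dom)//.
have mpdf : measurable_fun setT (EFin \o normal_pdf mu s).
  by apply/measurable_EFinP; exact: measurable_normal_pdf.
have iRN := Radon_Nikodym_SigmaFinite.f_integrable dom.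
apply: ae_eq_integral => //.
- by apply: emeasurable_funM => //; exact: measurable_int iRN.
- exact: emeasurable_funM.
- apply: ae_eqe_mul2l; apply: integral_ae_eq => // E _ mE.
  by rewrite -Radon_Nikodym_SigmaFinite.f_integral.
Qed.

(** With [z = (x - mu)^2 / (4 s^2)] the density is a constant times [exp(-z) * exp(-z)]. One factor
    absorbs [z^2], the other is the shape of the density of variance [2 s^2]. The constant is
    [128 = 16 * 2 * 4]: 16 from [(x - mu)^4 = 16 s^4 z^2], 2 above the ratio [sqrt 2] of the peaks,
    4 from [z^2 exp(-z) <= 4]. *)
Lemma normal_pdf_moment4 mu s x : s != 0 ->
  (x - mu) ^+ 4 * normal_pdf mu s x <=
  128 * s ^+ 4 * normal_pdf mu (Num.sqrt 2 * s) x.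
Proof.
move=> s0.
have r0 : 0 < Num.sqrt 2 :> R by rewrite sqrtr_gt0.
have r2 : Num.sqrt 2 ^+ 2 = 2 :> R by rewrite sqr_sqrtr.
have r2le : Num.sqrt 2 <= 2 :> R.
  by rewrite -(@ler_pXn2r _ 2)// ?nnegrE ?ltW// r2; lra.
have s20 : 0 < s ^+ 2 by rewrite exprn_even_gt0.
rewrite !normal_pdfE ?mulf_neq0 ?(gt_eqF r0)//.
have -> : normal_peak s = Num.sqrt 2 * normal_peak (Num.sqrt 2 * s).
  rewrite /normal_peak exprMn r2.
  rewrite (_ : 2 * s ^+ 2 * pi *+ 2 = 2 * (s ^+ 2 * pi *+ 2)); last by ring.
  rewrite sqrtrM// invfM mulrA divff ?mul1r//.
pose z := (x - mu) ^+ 2 / (4 * s ^+ 2).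
have z0 : 0 <= z by rewrite divr_ge0 ?sqr_ge0// mulr_ge0// ltW.
have -> : normal_fun mu s x = expR (- z) * expR (- z).
  rewrite -expRD /normal_fun; congr expR; rewrite /z -mulr_natr.
  by field; rewrite s0.
have -> : normal_fun mu (Num.sqrt 2 * s) x = expR (- z).
  rewrite /normal_fun; congr expR; rewrite /z exprMn r2 -mulr_natr.
  by field; rewrite s0.
have -> : (x - mu) ^+ 4 = 16 * s ^+ 4 * z ^+ 2.
  by rewrite /z; field; rewrite s0.
(* From [1 + z/2 <= exp(z/2)] one has [z <= 2 exp(z/2)], which is then squared. *)
have ze : z ^+ 2 * expR (- z) <= 4.
  have e0 : 0 < expR (z / 2) by exact: expR_gt0.
  have -> : expR (- z) = (expR (z / 2) ^+ 2)^-1.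
    by rewrite expRN; congr (_^-1); rewrite -expRM_natl; congr expR; field.
  rewrite ler_pdivrMr ?exprn_gt0//.
  have := expR_ge1Dx (z / 2) => h.
  have -> : 4 * expR (z / 2) ^+ 2 = (2 * expR (z / 2)) ^+ 2 by ring.
  by rewrite ler_pXn2r ?nnegrE ?z0 ?(mulr_ge0 _ (ltW e0))//; lra.
set pk := normal_peak _; set E := expR (- z).
have pk0 : 0 <= pk by exact: normal_peak_ge0.
have E0 : 0 <= E by exact: expR_ge0.
rewrite [leLHS](_ : _ = (16 * s ^+ 4 * pk * E) * (Num.sqrt 2 * (z ^+ 2 * E)));
  last by ring.
rewrite [leRHS](_ : _ = (16 * s ^+ 4 * pk * E) * (2 * 4)); last by ring.
have s40 : 0 <= s ^+ 4 by rewrite exprn_even_ge0.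
apply: ler_wpM2l; first by rewrite (mulr_ge0 (mulr_ge0 (mulr_ge0 _ s40) pk0) E0).
by apply: ler_pM => //; rewrite (mulr_ge0 (sqr_ge0 z)).
Qed.

Lemma normal_prob_moment4 mu s : s != 0 ->
  (\int[normal_prob mu s]_x ((x - mu) ^+ 4)%:E <= (128 * s ^+ 4)%:E)%E.
Proof.
move=> s0; have m4 : measurable_fun setT (fun x : R => (x - mu) ^+ 4).
  by apply: measurable_funX; exact: measurable_funB.
have mpdf t : measurable_fun setT (normal_pdf mu t).
  exact: measurable_normal_pdf.
rewrite ge0_integral_normal_prob; first last.
- exact/measurable_EFinP.
- by move=> x; rewrite lee_fin exprn_even_ge0.
apply: (@le_trans _ _ (\int[lebesgue_measure]_x
   ((128 * s ^+ 4)%:E * (normal_pdf mu (Num.sqrt 2 * s) x)%:E))%E).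
  apply: ge0_le_integral => //.
  - move=> x _; rewrite -EFinM lee_fin.
    by apply: mulr_ge0; [exact: exprn_even_ge0|exact: normal_pdf_ge0].
  - by apply: emeasurable_funM; apply/measurable_EFinP => //; exact: mpdf.
  - apply: emeasurable_funM; first exact: measurable_cst.
    by apply/measurable_EFinP; exact: mpdf.
  - by move=> x _; rewrite -!EFinM lee_fin; exact: normal_pdf_moment4.
rewrite integralZl//; last exact: integrable_normal_pdf.
by rewrite integral_normal_pdf mule1.
Qed.

(** The interval has length [|s|] and the density is at most its peak, so the mass is at most
    [1 / sqrt(2 pi) <= 1/2]. The interval is centred at 0, not at [mu], so that the estimate
    controls [s] before anything is known about [mu]. *)
Lemma normal_prob_small_ball mu s : s != 0 ->
  (normal_prob mu s `[(- (`|s| / 2))%R, (`|s| / 2)%R] <= (2^-1)%:E)%E.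
Proof.
move=> s0; rewrite /normal_prob.
have s1 : 0 < `|s| by rewrite normr_gt0.
apply: (@le_trans _ _
  (\int[lebesgue_measure]_(x in `[(- (`|s| / 2))%R, (`|s| / 2)%R]) (normal_peak s)%:E)%E).
  apply: ge0_le_integral => //.
  - by move=> x _; rewrite lee_fin normal_pdf_ge0.
  - by apply/measurable_EFinP/measurable_funTS; exact: measurable_normal_pdf.
  - by move=> x _; rewrite lee_fin normal_pdf_ub.
rewrite integral_cst// [X in (_ * X)%E](_ : _ = `|s|%:E); last first.
  etransitivity; first exact: lebesgue_measure_itv.
  rewrite /= lte_fin ifT; last by lra.
  by rewrite -EFinD; congr EFin; field.
rewrite -EFinM lee_fin.
rewrite /normal_peak mulrC ler_pdivrMr; last first.
  by rewrite sqrtr_gt0 mulrn_wgt0// mulr_gt0 ?pi_gt0// exprn_even_gt0.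
have -> : (s ^+ 2 * pi *+ 2) = `|s| ^+ 2 * (pi *+ 2).
  by rewrite (real_normK (num_real s)); ring.
rewrite sqrtrM ?sqr_ge0// sqrtr_sqr normr_id.
have : 2 <= Num.sqrt (pi *+ 2) :> R.
  rewrite -(@ler_pXn2r _ 2)// ?nnegrE ?sqrtr_ge0// sqr_sqrtr.
    by have := pi_ge2 R; lra.
  by rewrite mulrn_wge0// pi_ge0.
by move: (Num.sqrt _) => q; nra.
Qed.

End normal_moments.

(** * Random variables with a normal law and unit second moment *)

Section normal_law.
Context (disp : measure_display) (T : measurableType disp) (R : realType).
Context (P : probability T R).

Definition has_normal_law (X : T -> R) : Prop :=
  exists mu s : R, forall B : set R, measurable B ->
    P (X @^-1` B) = normal_law mu s B.

(* The location and scale are controlled by the second moment: half of the mass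
   of N(mu, s^2) lies outside of [-|s|/2, |s|/2], whence s^2 <= 8, and
   mu^2 <= 2 X^2 + 2 (X - mu)^2. *)
Lemma normal_law_moment4 : exists2 C : R, 0 <= C & forall X : T -> R,
  measurable_fun setT X -> has_normal_law X ->
  (\int[P]_w (X w ^+ 2)%:E = 1)%E ->
  P.-integrable setT (EFin \o (fun w => X w ^+ 4)) /\
  \int[P]_w (X w ^+ 4) <= C.
Proof.
(* [K] bounds the fourth central moment [128 s^4] once [s^2 <= 8]; [L] bounds [mu^2] through
   [mu^2 <= 2 X^2 + 2 + 2 (X - mu)^4]. The fourth moment is then at most [8 K + 8 L^2], and the
   extra 1 covers the degenerate law. *)
pose K : R := 128 * 64; pose L : R := 4 + 2 * K.
have K0 : 0 <= K by rewrite /K; lra.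
exists (8 * K + 8 * L ^+ 2 + 1); first by have := sqr_ge0 L; lra.
move=> X mX [mu [s Xlaw]] X2.
have mX4 : measurable_fun setT (fun w => X w ^+ 4) by exact: measurable_funX.
have transfer (nu : {measure set (measurableTypeR R) -> \bar R}) (g : R -> \bar R) :
    (forall B, measurable B -> P (X @^-1` B) = nu B) ->
    measurable_fun setT g -> (forall x, 0 <= g x)%E ->
    (\int[P]_w g (X w) = \int[nu]_x g x)%E.
  move=> Pnu mg g0.
  pose X' : {mfun T >-> measurableTypeR R} :=
    HB.pack X (isMeasurableFun.Build _ _ T (measurableTypeR R) X mX).
  have -> : (\int[nu]_x g x = \int[distribution P X']_x g x)%E.
    by apply: eq_measure_integral => B mB _; rewrite -Pnu.
  by rewrite ge0_integral_distribution.
have iX2 : P.-integrable setT (EFin \o (fun w => X w ^+ 2)).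
  apply/integrableP; split.
    by apply/measurable_EFinP; exact: measurable_funX.
  under eq_integral do rewrite /= ger0_norm ?sqr_ge0//.
  by rewrite X2 ltry.
have RX2 : \int[P]_w (X w ^+ 2) = 1 by rewrite /Rintegral X2.
(* In the degenerate case the law is the Dirac mass at [mu], so [mu^2 = 1] and the fourth moment is
   1. *)
have [s0|s0] := eqVneq s 0.
  have PX B : measurable B -> P (X @^-1` B) = (\d_mu B)%E.
    by move=> mB; rewrite Xlaw// /normal_law s0 eqxx.
  have mp n : measurable_fun setT (fun x : R => (x ^+ n)%:E).
    by apply/measurable_EFinP; exact: measurable_funX.
  have mu2 : mu ^+ 2 = 1.
    apply/EFin_inj; rewrite -[RHS]X2.
    rewrite (transfer (@dirac _ (measurableTypeR R) mu R) (fun x => (x ^+ 2)%:E))//.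
      by rewrite integral_dirac//; [rewrite diracT mul1e|exact: mp].
    by move=> x; rewrite lee_fin sqr_ge0.
  have X4 : (\int[P]_w (X w ^+ 4)%:E = 1)%E.
    rewrite (transfer (@dirac _ (measurableTypeR R) mu R) (fun x => (x ^+ 4)%:E))//.
      rewrite integral_dirac//; last exact: mp.
      by rewrite diracT mul1e (exprM mu 2 2) mu2 expr1n.
    by move=> x; rewrite lee_fin exprn_even_ge0.
  split; last by rewrite /Rintegral X4/=; have := sqr_ge0 L; lra.
  apply/integrableP; split; first exact/measurable_EFinP.
  under eq_integral do rewrite /= ger0_norm ?exprn_even_ge0//.
  by rewrite X4 ltry.
have PX B : measurable B -> P (X @^-1` B) = normal_prob mu s B.
  by move=> mB; rewrite Xlaw// /normal_law (negbTE s0).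
have Xc4 : (\int[P]_w ((X w - mu) ^+ 4)%:E <= (128 * s ^+ 4)%:E)%E.
  rewrite (transfer (normal_prob mu s) (fun x => ((x - mu) ^+ 4)%:E))//.
  - exact: normal_prob_moment4.
  - by apply/measurable_EFinP/measurable_funX; exact: measurable_funB.
  - by move=> x; rewrite lee_fin exprn_even_ge0.
have iXc4 : P.-integrable setT (EFin \o (fun w => (X w - mu) ^+ 4)).
  apply/integrableP; split.
    by apply/measurable_EFinP/measurable_funX; exact: measurable_funB.
  under eq_integral do rewrite /= ger0_norm ?exprn_even_ge0//.
  exact: le_lt_trans Xc4 (ltry _).
have s8 : s ^+ 2 <= 8.
  pose A := X @^-1` `[- (`|s| / 2), `|s| / 2].
  have mA : measurable A by rewrite -[A]setTI; exact: mX.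
  have PA : (P A <= (2^-1)%:E)%E by rewrite PX//; exact: normal_prob_small_ball.
  have iA : P.-integrable setT (EFin \o \1_A) by exact: integrable_indic.
  have RA : \int[P]_w \1_A w <= 2^-1.
    rewrite -lee_fin /Rintegral fineK ?integrable_fin_num//.
    by rewrite integral_indic// setIT.
  (* Off [A] one has [X^2 >= s^2 / 4], hence [(s^2 / 4) (1 - P(A)) <= 1]; with [P(A) <= 1/2] this
     gives [s^2 <= 8]. *)
  have : \int[P]_w (s ^+ 2 / 4 + (- (s ^+ 2 / 4)) * \1_A w) <= 1.
    rewrite -[leRHS]RX2; apply: le_Rintegral => //.
      by apply: integrableD_EFin; [exact: integrable_cst_EFin|exact: integrableZ_EFin].
    move=> w _; rewrite indicE; have [wA|wA] := boolP (w \in A).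
      by rewrite mulr1; have := sqr_ge0 (X w); lra.
    have : `|s| / 2 <= `|X w|.
      rewrite leNgt; apply: contra wA => h; rewrite inE /A/= in_itv/=.
      by rewrite -ler_norml ltW.
    rewrite mulr0 addr0 -(real_normK (num_real (X w))) -(real_normK (num_real s)).
    have := normr_ge0 s; move: `|s| `|X w| => a b a0 ab.
    by have : 0 <= (b - a / 2) * (b + a / 2); [apply: mulr_ge0; lra|lra].
  rewrite RintegralD//; [|exact: integrable_cst_EFin|exact: integrableZ_EFin].
  rewrite Rintegral_prob_cst RintegralZl//.
  by have := sqr_ge0 s; move: (s ^+ 2) => q; nra.
have KE : \int[P]_w (X w - mu) ^+ 4 <= K.
  apply: (@le_trans _ _ (128 * s ^+ 4)).
    by rewrite -lee_fin /Rintegral fineK// integrable_fin_num.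
  rewrite /K ler_wpM2l//.
  rewrite (exprM s 2 2); have := sqr_ge0 s; move: (s ^+ 2) s8 => q q8 q0.
  by have : 0 <= (8 - q) * (8 + q); [apply: mulr_ge0; lra|lra].
have muL : mu ^+ 2 <= L.
  have -> : mu ^+ 2 = \int[P]_w (mu ^+ 2).
    by rewrite Rintegral_prob_cst.
  have i1 := integrableD_EFin (integrableD_EFin (integrableZ_EFin 2 iX2)
    (integrable_cst_EFin P 2)) (integrableZ_EFin 2 iXc4).
  apply: (@le_trans _ _ (\int[P]_w (2 * X w ^+ 2 + 2 + 2 * (X w - mu) ^+ 4))).
    apply: le_Rintegral => //; first exact: integrable_cst_EFin.
    move=> w _; have := sqr_ge0 (X w + (X w - mu)).
    rewrite (exprM (X w - mu) 2 2); have := sqr_ge0 (X w - mu).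
    have := sqr_ge0 ((X w - mu) ^+ 2 - 1).
    have : mu = X w - (X w - mu) by ring.
    move: (X w - mu) => v -> /=; nra.
  rewrite RintegralD//; [|exact: integrableD_EFin (integrableZ_EFin 2 iX2)
    (integrable_cst_EFin P 2)|exact: integrableZ_EFin].
  rewrite RintegralD//; [|exact: integrableZ_EFin|exact: integrable_cst_EFin].
  rewrite Rintegral_prob_cst !RintegralZl// RX2.
  by rewrite /L; lra.
have i2 := integrableD_EFin (integrableZ_EFin 8 iXc4) (integrable_cst_EFin P (8 * mu ^+ 4)).
have le4 w : X w ^+ 4 <= 8 * (X w - mu) ^+ 4 + 8 * mu ^+ 4.
  have : X w = (X w - mu) + mu by ring.
  move: (X w - mu) => v ->.
  have h1 : (v + mu) ^+ 2 <= 2 * (v ^+ 2 + mu ^+ 2).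
    by have := sqr_ge0 (v - mu); lra.
  have h2 : ((v + mu) ^+ 2) ^+ 2 <= (2 * (v ^+ 2 + mu ^+ 2)) ^+ 2.
    by rewrite ler_pXn2r ?nnegrE ?sqr_ge0// mulr_ge0// addr_ge0 ?sqr_ge0.
  by move: h2; have := sqr_ge0 (v ^+ 2 - mu ^+ 2); lra.
have iX4 : P.-integrable setT (EFin \o (fun w => X w ^+ 4)).
  apply: (integrable_le mX4 i2) => w.
  by rewrite ger0_norm ?exprn_even_ge0.
split=> //.
apply: (@le_trans _ _ (\int[P]_w (8 * (X w - mu) ^+ 4 + 8 * mu ^+ 4))).
  by apply: le_Rintegral => // w _; exact: le4.
rewrite RintegralD//; [|exact: integrableZ_EFin|exact: integrable_cst_EFin].
rewrite Rintegral_prob_cst RintegralZl//.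
rewrite (exprM mu 2 2); have := sqr_ge0 mu; have L0 : 0 <= L by rewrite /L; lra.
by move: (mu ^+ 2) muL KE => q; nra.
Qed.

End normal_law.

(** * Independence *)

Section independence.
Context (disp : measure_display) (T : measurableType disp) (R : realType).
Context (P : probability T R).

(** Independence on rectangles identifies the law of [(X, Y)] with the product of the marginal laws,
    and Fubini factors the integral. *)
Lemma independent_RintegralM (X Y : T -> R) :
  measurable_fun setT X -> measurable_fun setT Y ->
  (forall B C : set R, measurable B -> measurable C ->
     P (X @^-1` B `&` Y @^-1` C) = (P (X @^-1` B) * P (Y @^-1` C))%E) ->
  P.-integrable setT (EFin \o X) -> P.-integrable setT (EFin \o Y) ->
  P.-integrable setT (EFin \o (fun w => X w * Y w)) ->
  \int[P]_w (X w * Y w) = \int[P]_w X w * \int[P]_w Y w.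
Proof.
move=> mX mY XY iX iY iXY.
pose X' : {mfun T >-> R} := HB.pack X (isMeasurableFun.Build _ _ T R X mX).
pose Y' : {mfun T >-> R} := HB.pack Y (isMeasurableFun.Build _ _ T R Y mY).
pose Z w := (X w, Y w).
have mZ : measurable_fun setT Z by exact: measurable_fun_pair.
pose Z' : {mfun T >-> (R * R)%type} :=
  HB.pack Z (isMeasurableFun.Build _ _ T (R * R)%type Z mZ).
pose m1 := distribution P X'; pose m2 := distribution P Y'.
pose m := distribution P Z'.
pose f (z : R * R) := (z.1 * z.2)%:E.
have mf : measurable_fun setT f.
  apply/measurable_EFinP; apply: measurable_funM.
    exact: measurable_fst.
  exact: measurable_snd.
have m12 A : measurable A -> (m1 \x m2)%E A = m A.
  apply: product_measure_unique => B C mB mC.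
  by rewrite -XY.
have im : m.-integrable setT f.
  exact: (@integrable_pushforward _ _ _ _ _ _ mZ P setT f mf iXY).
have i12 : (m1 \x m2)%E.-integrable setT f.
  apply/integrableP; split=> //; move/integrableP : im => [_].
  congr (_ < _)%E; apply: eq_measure_integral => A mA _.
  by apply/esym; exact: m12.
have iy : m2.-integrable setT (EFin : R -> _).
  apply: (@integrable_pushforward _ _ _ _ _ _ mY P setT EFin) => //.
have ix : m1.-integrable setT (EFin : R -> _).
  apply: (@integrable_pushforward _ _ _ _ _ _ mX P setT EFin) => //.
rewrite /Rintegral.
have -> : (\int[P]_w (X w * Y w)%:E = \int[m]_z f z)%E.
  by rewrite integral_distribution.
have -> : (\int[m]_z f z = \int[m1 \x m2]_z f z)%E.
  by apply: eq_measure_integral => A mA _; apply/esym; exact: m12.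
rewrite -integral12_prod_meas1//.
have EY : (\int[P]_w (Y w)%:E = \int[m2]_y y%:E)%E by rewrite integral_distribution.
have EX : (\int[P]_w (X w)%:E = \int[m1]_x x%:E)%E by rewrite integral_distribution.
rewrite EX EY -fineM; [|exact: integrable_fin_num..].
congr fine.
rewrite /fubini_F /f /=.
under eq_integral.
  move=> x _; under eq_integral do rewrite EFinM.
  rewrite integralZl//.
  rewrite -(fineK (integrable_fin_num measurableT iy)).
  over.
by rewrite integralZr// fineK// integrable_fin_num.
Qed.

Variables (I : choiceType) (a : nat) (X : I -> T -> 'cV[R]_a).
Hypothesis mX : forall t, random_vector (X t).
Hypothesis indepX : independent_vectors P X.

(** The generating class inside [sigma_vector], named so that measurability with respect to a single
    vector can be stated through [g_sigma_algebraType]. *)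
Definition vector_generators (t : I) : set (set T) :=
  [set A | exists i, exists2 B : set R,
     measurable B & A = (fun w => X t w i 0) @^-1` B].

(** Only a union of sigma-algebras; it serves as the generating class of the sigma-algebra of all
    vectors but the one at [q]. *)
Definition other_vectors (q : I) : set (set T) :=
  \bigcup_(t in [set t | t != q]) sigma_vector (X t).

Lemma sigma_vector_measurable t A : sigma_vector (X t) A -> measurable A.
Proof.
apply: smallest_sub; first exact: sigma_algebra_measurable.
by move=> _ [i [B mB ->]]; rewrite -[_ @^-1` _]setTI; exact: mX.
Qed.

(** A pi-lambda argument. The finite intersections of events attached to indices other than [q] form
    a class [G] that is stable under intersection and generates the same events. The finite measures
    [P(A]&[_)] and [P(A) P(_)] agree on [G], hence on the generated sigma-algebra. *)
Lemma independent_other_vectors q A B :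
  sigma_vector (X q) A -> <<s other_vectors q >> B ->
  P (A `&` B) = (P A * P B)%E.
Proof.
move=> sA sB; have mA := sigma_vector_measurable sA.
pose G := [set B | exists (J : {fset I}) (F : I -> set T),
  [/\ q \notin J, forall t, sigma_vector (X t) (F t) &
      B = \bigcap_(t in [set` J]) F t]].
have sT t : sigma_vector (X t) setT.
  exact: (@measurableT _ (g_sigma_algebraType (vector_generators t))).
have sI t C D : sigma_vector (X t) C -> sigma_vector (X t) D ->
    sigma_vector (X t) (C `&` D).
  exact: (@measurableI _ (g_sigma_algebraType (vector_generators t))).
have mG : G `<=` measurable.
  move=> _ [J [F [_ sF ->]]]; apply: fin_bigcap_measurable => // t _.
  exact: sigma_vector_measurable.
have GT : G setT.
  exists fset0, (fun=> setT); split=> //.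
  by rewrite set_fset0 bigcap_set0.
have GI : setI_closed G.
  move=> _ _ [J1 [F1 [qJ1 sF1 ->]]] [J2 [F2 [qJ2 sF2 ->]]].
  exists (J1 `|` J2)%fset, (fun t => (if t \in J1 then F1 t else setT) `&`
    (if t \in J2 then F2 t else setT)); split.
  - by rewrite inE negb_or qJ1.
  - by move=> t; apply: sI; case: ifP.
  - apply/seteqP; split=> w /=.
      by move=> [w1 w2] t _; split; case: ifPn => // tJ; [exact: w1|exact: w2].
    move=> h; split=> t tJ.
      by have /h[] : t \in (J1 `|` J2)%fset; [rewrite inE tJ|rewrite tJ].
    have /h[_] : t \in (J1 `|` J2)%fset by rewrite inE tJ orbT.
    by rewrite tJ.
have PA0 : 0 <= fine (P A) by rewrite fine_ge0.
pose m1 : {measure set T -> \bar R} := mrestr P mA.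
pose m2 : {measure set T -> \bar R} := mscale (NngNum PA0) P.
have m2E C : m2 C = (P A * P C)%E by rewrite /m2/= /mscale/= fineK// fin_num_measure.
suff : m1 B = m2 B by rewrite m2E /m1/= /mrestr setIC.
have sGB : <<s G >> B.
  have : <<s other_vectors q >> `<=` <<s G >>.
    apply: smallest_sub; first exact: smallest_sigma_algebra.
    move=> C [t /= tq sC]; apply: sub_sigma_algebra.
    exists [fset t]%fset, (fun s => if s == t then C else setT); split.
    - by rewrite inE eq_sym.
    - by move=> s; case: eqP => // ->.
    - by rewrite set_fset1 bigcap_set1 eqxx.
  exact.
apply: (@g_sigma_algebra_measure_unique _ _ _ G mG (fun=> setT)) => //.
- by rewrite bigcup_const.
- move=> _ [J [F [qJ sF ->]]]; rewrite m2E /m1/= /mrestr.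
  (* [A] is placed at the free index [q]: independence over [J] with [q] added gives [P(A)] times
     the product over [J], which independence over [J] turns back into the probability of the
     intersection. *)
  have sF' t : sigma_vector (X t) (if t == q then A else F t).
    by case: eqP => // ->.
  have /= := indepX (J := (q |` J)%fset) (fun t _ => sF' t).
  have -> : \bigcap_(t in [set` (q |` J)%fset]) (if t == q then A else F t) =
      \bigcap_(t in [set` J]) F t `&` A.
    apply/seteqP; split=> w /=.
      move=> h; split; last by have := h q; rewrite /= eqxx; apply; rewrite !inE eqxx.
      move=> t /= tJ; have := h t; rewrite /= ifN; last first.
        by apply: contra qJ => /eqP <-.
      by apply; rewrite !inE tJ orbT.
    move=> [h wA] t /=; rewrite !inE => /orP[->//|tJ].
    by case: eqP => // _; exact: h.
  move=> ->; rewrite big_fsetU1//= eqxx; congr (_ * _)%E.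
  rewrite (indepX (fun t _ => sF t)); rewrite big_seq [RHS]big_seq.
  by apply: eq_bigr => t tJ; rewrite ifN//; apply: contra qJ => /eqP <-.
- by move=> _; rewrite /m1/= /mrestr setTI ltey_eq fin_num_measure.
Qed.

Lemma vector_coord_measurable t i :
  measurable_fun (setT : set (g_sigma_algebraType (vector_generators t)))
    (fun w => X t w i 0).
Proof.
by move=> _ B mB; rewrite setTI; apply: sub_sigma_algebra; exists i, B.
Qed.

Lemma other_coord_measurable q t i : t != q ->
  measurable_fun (setT : set (g_sigma_algebraType (other_vectors q)))
    (fun w => X t w i 0).
Proof.
move=> tq _ B mB; rewrite setTI; apply: sub_sigma_algebra; exists t => //.
by apply: sub_sigma_algebra; exists i, B.
Qed.

(** The form in which independence is used: a function of the vector at [q] splits off from any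
    function of the remaining ones. *)
Lemma other_vectors_RintegralM q (U V : T -> R) :
  measurable_fun (setT : set (g_sigma_algebraType (vector_generators q))) U ->
  measurable_fun (setT : set (g_sigma_algebraType (other_vectors q))) V ->
  P.-integrable setT (EFin \o U) -> P.-integrable setT (EFin \o V) ->
  P.-integrable setT (EFin \o (fun w => U w * V w)) ->
  \int[P]_w (U w * V w) = \int[P]_w U w * \int[P]_w V w.
Proof.
move=> mU mV iU iV iUV; apply: independent_RintegralM => //.
- exact: integrable_measurable_fun iU.
- exact: integrable_measurable_fun iV.
- move=> B C mB mC; apply: (@independent_other_vectors q).
    by have := mU measurableT B mB; rewrite setTI.
  by have := mV measurableT C mC; rewrite setTI.
Qed.

End independence.

(** * White noise *)

(** Subtracting the equations gives [2u = 2v], and the lattice has no 2-torsion. *)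
Lemma Zlat_crossed_shifts (d : nat) (t s u v : Zlat d) :
  t + u = s + v -> t + v = s + u -> u = v.
Proof.
move=> /ffunP h1 /ffunP h2; apply/ffunP => j.
by have := h1 j; have := h2 j; rewrite !ffunE; lra.
Qed.

Section noise.
Context (disp : measure_display) (T : measurableType disp) (R : realType).
Context (P : probability T R) (d p : nat) (e : Zlat d -> T -> 'cV[R]_p).
Hypothesis e_noise : white_gaussian_noise P e.
Implicit Types (q t s u v x y : Zlat d) (i j : 'I_p).

Let random_e t : random_vector (e t).
Proof. by case: e_noise => /(_ t)[]. Qed.

Let indep_e : independent_vectors P e.
Proof. by case: e_noise. Qed.

Let me x i : measurable_fun setT (fun w => e x w i 0).
Proof. exact: random_e. Qed.

Let noise_law x i : has_normal_law P (fun w => e x w i 0).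
Proof.
case: e_noise => /(_ x)[_ /(_ (delta_mx i 0))[mu [s h]]] _ _ _.
exists mu, s => B mB; rewrite -h//; congr (P (_ @^-1` B)).
apply/funext => w; rewrite mxE (bigD1 i)//= big1 ?addr0.
  by rewrite !mxE !eqxx mul1r.
by move=> k ki; rewrite !mxE (negbTE ki) mul0r.
Qed.

Let mean0 x i : ('E_P[fun w => (e x w i 0)%R] = 0)%E.
Proof. by case: e_noise => _ _ /(_ x i) + _; rewrite [ord0]ord1. Qed.

(** The means vanish, so the covariance is the plain product moment. The identity is kept in the
    extended reals because square integrability of the noise is deduced from it. *)
Lemma noise_covariance x i j :
  (\int[P]_w (e x w i 0 * e x w j 0)%:E = ((i == j)%:R)%:E)%E.
Proof.
case: e_noise => _ _ _ /(_ x i j) <-.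
rewrite covariance.unlock !mean0 expectation.unlock; apply: eq_integral => w _.
by rewrite /=  /GRing.mul/= !subr0.
Qed.

Lemma noise_sqint x i : sqint P (fun w => e x w i 0).
Proof.
split=> //; apply/integrableP; split.
  by apply/measurable_EFinP; exact: measurable_funX.
under eq_integral do rewrite /= ger0_norm ?sqr_ge0// expr2.
by rewrite noise_covariance ltry.
Qed.

Lemma noise_mean x i : \int[P]_w (e x w i 0) = 0.
Proof.
by have := mean0 x i; rewrite unlock /Rintegral => ->.
Qed.

Lemma noise_moment4 : exists2 C : R, 0 <= C & forall x i,
  P.-integrable setT (EFin \o (fun w => e x w i 0 ^+ 4)) /\
  \int[P]_w (e x w i 0 ^+ 4) <= C.
Proof.
have [C C0 h] := normal_law_moment4 P; exists C => // x i.
apply: h => //; under eq_integral do rewrite expr2.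
by rewrite noise_covariance eqxx.
Qed.

Lemma noiseM_sqint x y i j : sqint P (fun w => e x w i 0 * e y w j 0).
Proof.
have [C _ h] := noise_moment4.
have [i4 _] := h x i; have [j4 _] := h y j.
split; first exact: measurable_funM.
apply: (integrable_le _ (integrableD_EFin i4 j4)).
  by apply: measurable_funX; exact: measurable_funM.
move=> w; rewrite ger0_norm ?sqr_ge0// exprMn.
rewrite (exprM _ 2 2) (exprM (e y w j 0) 2 2).
have := sqr_ge0 (e x w i 0); have := sqr_ge0 (e y w j 0).
move: (e x w i 0 ^+ 2) (e y w j 0 ^+ 2) => a b b0 a0.
by have := sqr_ge0 (a - b); have := mulr_ge0 a0 b0; lra.
Qed.

Let coord_q q i :
  measurable_fun (setT : set (g_sigma_algebraType (vector_generators e q)))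
    (fun w => e q w i 0).
Proof. exact: vector_coord_measurable. Qed.

Let coord_o q t i : t != q ->
  measurable_fun (setT : set (g_sigma_algebraType (other_vectors e q)))
    (fun w => e t w i 0).
Proof. exact: other_coord_measurable. Qed.

Lemma noise_cross_moment x y i j :
  \int[P]_w (e x w i 0 * e y w j 0) = ((x == y) && (i == j))%:R.
Proof.
have [<-|xy] := eqVneq x y; first by rewrite /Rintegral noise_covariance.
rewrite (other_vectors_RintegralM random_e indep_e (q := x)).
- by rewrite noise_mean mul0r.
- exact: coord_q.
- by apply: coord_o; rewrite eq_sym.
- exact: sqint_integrable (noise_sqint x i).
- exact: sqint_integrable (noise_sqint y j).
- exact: sqint_integrable (noiseM_sqint x y i j).
Qed.

(** The subtracted constant is the mean of the product, because [t + u = t + v] exactly when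
    [u = v]; it does not depend on [t]. *)
Definition noise_product u v i j t (w : T) : R :=
  e (t + u) w i 0 * e (t + v) w j 0 - ((u == v) && (i == j))%:R.

Lemma noise_product_sqint u v i j t : sqint P (noise_product u v i j t).
Proof. by apply: sqintB; [exact: noiseM_sqint|exact: sqint_cst]. Qed.

(** For a constant [c] in {0, 1}, [(a b - c)^2 <= a^4 + b^4 + 2], and the fourth moments of the
    noise are bounded uniformly. *)
Lemma noise_product_bound : exists2 B : R, 0 <= B & forall u v i j t,
  \int[P]_w (noise_product u v i j t w) ^+ 2 <= B.
Proof.
have [C C0 h] := noise_moment4; exists (2 * C + 2); first by lra.
move=> u v i j t.
have [i4 iC] := h (t + u) i; have [j4 jC] := h (t + v) j.
have [_ i2] := noise_product_sqint u v i j t.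
apply: (@le_trans _ _
   (\int[P]_w (e (t + u) w i 0 ^+ 4 + e (t + v) w j 0 ^+ 4 + 2))).
  apply: le_Rintegral => //.
    by apply: integrableD_EFin (integrable_cst_EFin _ _); exact: integrableD_EFin.
  move=> w _; rewrite /noise_product.
  have : ((u == v) && (i == j))%:R ^+ 2 <= 1 :> R.
    by case: (_ && _); rewrite ?expr1n// expr0n.
  move: (e _ w i 0) (e _ w j 0) (_%:R) => a b c c1.
  have := sqr_ge0 (a * b + c); have := sqr_ge0 (a ^+ 2 - b ^+ 2); lra.
rewrite RintegralD//; [|exact: integrableD_EFin|exact: integrable_cst_EFin].
by rewrite RintegralD// Rintegral_prob_cst; lra.
Qed.

(** A product in which the index [q] occurs once: that factor is centred and independent of the
    other three. *)
Let fourfold q x1 x2 x3 i i1 i2 i3 : x1 != q -> x2 != q -> x3 != q ->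
  \int[P]_w (e q w i 0 * e x1 w i1 0 * (e x2 w i2 0 * e x3 w i3 0)) = 0.
Proof.
move=> q1 q2 q3; have s1 := noiseM_sqint q x1 i i1.
have s2 := noiseM_sqint x2 x3 i2 i3.
under eq_Rintegral do rewrite -mulrA.
rewrite (other_vectors_RintegralM random_e indep_e (q := q)).
- by rewrite noise_mean mul0r.
- exact: coord_q.
- apply: measurable_funM; first exact: coord_o.
  by apply: measurable_funM; exact: coord_o.
- exact: sqint_integrable (noise_sqint q i).
- exact: sqintM (noise_sqint x1 i1) s2.
- have := sqintM s1 s2; apply: eq_integrable => // w _ /=.
  by rewrite -mulrA.
Qed.

Lemma noise_product_orthogonal u v i j t s : t != s ->
  \int[P]_w (noise_product u v i j t w * noise_product u v i j s w) = 0.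
Proof.
move=> ts.
have st : s != t by rewrite eq_sym.
have tsD (x : Zlat d) : t + x != s + x by rewrite (inj_eq (addIr x)).
(* If [u = v], the two variables are functions of the noise at [t + u] and at [s + u], hence
   independent, and they are centred. *)
have [uv|uv] := eqVneq u v.
  subst v; have pmean0 : \int[P]_w noise_product u u i j t w = 0.
    rewrite RintegralB//; [|exact: sqint_integrable (noiseM_sqint _ _ _ _)|
      exact: integrable_cst_EFin].
    by rewrite noise_cross_moment Rintegral_prob_cst !eqxx subrr.
  rewrite (other_vectors_RintegralM random_e indep_e (q := t + u)).
  - by rewrite pmean0 mul0r.
  - apply: measurable_funB => //.
    by apply: measurable_funM; exact: coord_q.
  - apply: measurable_funB => //.
    by apply: measurable_funM; apply: coord_o; rewrite eq_sym.
  - exact: sqint_integrable (noise_product_sqint _ _ _ _ _).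
  - exact: sqint_integrable (noise_product_sqint _ _ _ _ _).
  - by apply: sqintM; exact: noise_product_sqint.
rewrite /noise_product (negbTE uv)/=.
under eq_Rintegral do rewrite !subr0.
have uvD (x : Zlat d) : x + u != x + v by rewrite (inj_eq (addrI x)).
(* The index [t + u] differs from [t + v] since [u != v] and from [s + u] since [t != s]; it is
   isolated unless it equals [s + v]. *)
have [h|h] := eqVneq (t + u) (s + v); last first.
  by apply: fourfold; rewrite eq_sym.
(* Now [t + u = s + v]. Swapping the first two factors isolates [t + v] instead, as
   [Zlat_crossed_shifts] forbids [t + v = s + u]. *)
under eq_Rintegral do rewrite [X in X * _]mulrC.
apply: fourfold => //; rewrite eq_sym//.
apply/negP => /eqP h'; move/negP: uv; apply; apply/eqP.
exact: Zlat_crossed_shifts h h'.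
Qed.

Lemma noise_product_sum (B : R) (s : seq (Zlat d)) u v i j : uniq s ->
  (forall t, \int[P]_w (noise_product u v i j t w) ^+ 2 <= B) ->
  \int[P]_w (\sum_(t <- s) noise_product u v i j t w) ^+ 2 <= (size s)%:R * B.
Proof.
move=> us hB; apply: orthogonal_sum_sqint => //.
  by move=> t; exact: noise_product_sqint.
by move=> t t'; exact: noise_product_orthogonal.
Qed.

End noise.

(** * Finite moving averages *)

Lemma near_all_seq (U : Type) (F : set_system U) (FF : Filter F) (I : eqType)
    (s : seq I) (Q : I -> U -> Prop) :
  (forall i, \forall A \near F, Q i A) ->
  \forall A \near F, forall i, i \in s -> Q i A.
Proof.
move=> FQ; elim: s => [|i s ih]; first by apply: nearW => A i; rewrite in_nil.
near=> A => j; rewrite inE => /predU1P[->|js].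
  by near: A; exact: FQ.
by move: j js; near: A; exact: ih.
Unshelve. all: by end_near. Qed.

Lemma sum_delta_le1 (R : numDomainType) (I : eqType) (s : seq I) (x : I) :
  uniq s -> \sum_(k <- s) (k == x)%:R <= 1 :> R.
Proof.
move=> us; have [xs|xs] := boolP (x \in s).
  rewrite (bigD1_seq x)//= eqxx big1 ?addr0// => k kx.
  by rewrite (negbTE kx).
rewrite big_seq big1// => k ks.
by case: eqP => // kx; rewrite kx (negbTE xs) in ks.
Qed.

Lemma frobenius_ge0 (R : realType) (m p : nat) (A : 'M[R]_(m, p)) :
  0 <= frobenius A.
Proof. exact: sqrtr_ge0. Qed.

Lemma frobenius_sqr (R : realType) (m p : nat) (A : 'M[R]_(m, p)) :
  frobenius A ^+ 2 = \sum_(i < m) \sum_(j < p) A i j ^+ 2.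
Proof.
rewrite sqr_sqrtr; last by do 2 apply: sumr_ge0 => ? _; rewrite sqr_ge0.
by do 2 apply: eq_bigr => ? _; rewrite real_normK// num_real.
Qed.

Lemma entry_sqr_le_frobenius (R : realType) (m p : nat) (A : 'M[R]_(m, p)) i j :
  A i j ^+ 2 <= frobenius A ^+ 2.
Proof.
rewrite frobenius_sqr (bigD1 i)//= (bigD1 j)//= -addrA lerDl addr_ge0//.
  by apply: sumr_ge0 => ? _; rewrite sqr_ge0.
by do 2 apply: sumr_ge0 => ? _; rewrite sqr_ge0.
Qed.

Lemma entry_le_frobenius (R : realType) (m p : nat) (A : 'M[R]_(m, p)) i j :
  `|A i j| <= frobenius A.
Proof.
rewrite -(@ler_pXn2r _ 2)// ?nnegrE ?frobenius_ge0//.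
by rewrite real_normK ?num_real// entry_sqr_le_frobenius.
Qed.

Section moving_average_moments.
Context (disp : measure_display) (T : measurableType disp) (R : realType).
Context (P : probability T R) (d m p : nat).
Variables (M : Zlat d -> 'M[R]_(m, p)) (e : Zlat d -> T -> 'cV[R]_p).
Hypothesis M_summable : (\esum_(s in [set: Zlat d]) (frobenius (M s))%:E < +oo)%E.
Hypothesis e_noise : white_gaussian_noise P e.
Implicit Types (A : {fset Zlat d}) (k t : Zlat d) (i j : 'I_m).

(** Pairs of a lag and a noise coordinate: each coordinate of the sum of matrix products becomes one
    scalar sum over such pairs. *)
Definition ma_index A : seq (Zlat d * 'I_p) :=
  [seq (s, a) | s <- A, a <- enum 'I_p].

Definition ma_coef i (q : Zlat d * 'I_p) : R := M q.1 i q.2.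

Definition finite_ma A t i (w : T) : R :=
  \sum_(q <- ma_index A) ma_coef i q * e (t - q.1) w q.2 0.

(** The autocovariance of [finite_ma] by bilinearity; the indicator is written with the shifts
    [k - q.1] and [- r.1] to match the constant in [noise_product]. *)
Definition finite_autocov A k i j : R :=
  \sum_(q <- ma_index A) \sum_(r <- ma_index A)
    ma_coef i q * ma_coef j r * ((k - q.1 == - r.1) && (q.2 == r.2))%:R.

Lemma partial_sum_entry A t i w :
  (summability.partial_sum (fun s => M s *m e (t - s) w) A) i 0 = finite_ma A t i w.
Proof.
rewrite /summability.partial_sum
  -(big_seq_fsetE _ _ predT (fun s => M s *m e (t - s) w)) summxE.
rewrite /finite_ma big_allpairs; apply: eq_bigr => s _.
by rewrite mxE big_enum.
Qed.

(** A row of [M s] has [p] entries, each at most the Frobenius norm, so [p] times the total of the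
    norms serves for all [A] and [i]. *)
Lemma ma_coef_bound : exists2 S : R, 0 <= S &
  forall A i, \sum_(q <- ma_index A) `|ma_coef i q| <= S.
Proof.
pose E := (\esum_(s in [set: Zlat d]) (frobenius (M s))%:E)%E.
have E0 : (0 <= E)%E by apply: esum_ge0 => s _; rewrite lee_fin frobenius_ge0.
have Efin : E \is a fin_num by rewrite ge0_fin_numE//; exact: M_summable.
exists (p%:R * fine E); first by rewrite mulr_ge0// fine_ge0.
move=> A i; rewrite big_allpairs.
have AE : \sum_(s <- A) frobenius (M s) <= fine E.
  rewrite -lee_fin fineK// -sumEFin; apply: esum_ge.
  exists [set` A]; first by split=> //; exact: finite_fset.
  by rewrite fsbig_finite ?set_fsetK//; exact: finite_fset.
rewrite (le_trans _ (ler_wpM2l (ler0n _ _) AE))// mulr_sumr.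
apply: ler_sum => s _; rewrite big_enum/= mulr_natl.
rewrite -[X in _ *+ X]card_ord -sumr_const; apply: ler_sum => a _.
exact: entry_le_frobenius.
Qed.

(** Neither the shifts nor the coefficients depend on [t], so a sum over [t] can be moved inside,
    where its terms are orthogonal. *)
Lemma finite_ma_product A k t i j w :
  finite_ma A (t + k) i w * finite_ma A t j w - finite_autocov A k i j =
  \sum_(q <- ma_index A) \sum_(r <- ma_index A) ma_coef i q * ma_coef j r *
    noise_product e (k - q.1) (- r.1) q.2 r.2 t w.
Proof.
rewrite /finite_ma /finite_autocov mulr_suml -sumrB; apply: eq_bigr => q _.
rewrite mulr_sumr -sumrB; apply: eq_bigr => r _.
by rewrite /noise_product addrA; ring.
Qed.

Lemma finite_ma_sqint A t i : sqint P (finite_ma A t i).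
Proof.
by apply: sqint_sum => q; apply: sqintZ; exact: noise_sqint e_noise _ _.
Qed.

Lemma finite_ma_autocov A k t i j :
  \int[P]_w (finite_ma A (t + k) i w * finite_ma A t j w) = finite_autocov A k i j.
Proof.
have iM := sqintM (finite_ma_sqint A (t + k) i) (finite_ma_sqint A t j).
apply/eqP; rewrite -subr_eq0 -[X in _ - X](Rintegral_prob_cst P).
rewrite -RintegralB//; last exact: integrable_cst_EFin.
under eq_Rintegral do rewrite finite_ma_product.
have iN q r : P.-integrable setT
    (EFin \o (fun w => ma_coef i q * ma_coef j r *
       noise_product e (k - q.1) (- r.1) q.2 r.2 t w)).
  apply: integrableZ_EFin; apply: sqint_integrable.
  exact: noise_product_sqint e_noise _ _ _ _ _.
rewrite Rintegral_sum; last by move=> q; exact: integrable_sum_EFin.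
rewrite big1// => q _; rewrite Rintegral_sum// big1// => r _.
have ip := noiseM_sqint e_noise (t + (k - q.1)) (t - r.1) q.2 r.2.
rewrite RintegralZl//; last first.
  by apply: sqint_integrable; exact: noise_product_sqint e_noise _ _ _ _ _.
rewrite RintegralB//; [|exact: sqint_integrable|exact: integrable_cst_EFin].
rewrite noise_cross_moment// Rintegral_prob_cst (inj_eq (addrI t)).
by rewrite subrr mulr0.
Qed.

(** For given [q] and [r] at most one lag contributes, namely [k = q.1 - r.1]; what remains is a
    product of two coefficient sums. *)
Lemma finite_autocov_summable (S : R) (K : seq (Zlat d)) A i j : uniq K ->
  0 <= S -> (forall i, \sum_(q <- ma_index A) `|ma_coef i q| <= S) ->
  \sum_(k <- K) `|finite_autocov A k i j| <= S ^+ 2.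
Proof.
move=> uK S0 SA.
apply: (@le_trans _ _ (\sum_(k <- K) \sum_(q <- ma_index A) \sum_(r <- ma_index A)
    `|ma_coef i q| * `|ma_coef j r| * (k == q.1 - r.1)%:R)).
  apply: ler_sum => k _.
  apply: le_trans (ler_norm_sum _ _ _) _; apply: ler_sum => q _.
  apply: le_trans (ler_norm_sum _ _ _) _; apply: ler_sum => r _.
  rewrite !normrM ler_wpM2l ?mulr_ge0// normr_nat ler_nat.
  by rewrite subr_eq [- _ + _]addrC; case: (k == _) => //; case: (_ == _).
rewrite exchange_big/=; under eq_bigr do rewrite exchange_big/=.
apply: (@le_trans _ _ (\sum_(q <- ma_index A) \sum_(r <- ma_index A)
    `|ma_coef i q| * `|ma_coef j r|)).
  apply: ler_sum => q _; apply: ler_sum => r _; rewrite -mulr_sumr.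
  by rewrite ler_piMr ?mulr_ge0// sum_delta_le1.
under eq_bigr do rewrite -mulr_sumr.
by rewrite -mulr_suml expr2 ler_pM// sumr_ge0.
Qed.

(** For each pair [(q, r)] orthogonality bounds the sum over [t] by [B] times the size of [Xi]. The
    L^2 triangle inequality over the pairs, whose coefficients total at most [S^2], then costs
    [S^4]. The bound is uniform in [A] and [k]. *)
Lemma finite_ma_variance (S B : R) (Xi : seq (Zlat d)) A k i j : uniq Xi ->
  0 <= S -> 0 <= B ->
  (forall i, \sum_(q <- ma_index A) `|ma_coef i q| <= S) ->
  (forall u v a b t, \int[P]_w (noise_product e u v a b t w) ^+ 2 <= B) ->
  \int[P]_w (\sum_(t <- Xi)
     (finite_ma A (t + k) i w * finite_ma A t j w - finite_autocov A k i j)) ^+ 2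
  <= S ^+ 4 * B * (size Xi)%:R.
Proof.
move=> uXi S0 B0 SA nB.
pose V (z : (Zlat d * 'I_p) * (Zlat d * 'I_p)) w :=
  \sum_(t <- Xi) noise_product e (k - z.1.1) (- z.2.1) z.1.2 z.2.2 t w.
pose c (z : (Zlat d * 'I_p) * (Zlat d * 'I_p)) := ma_coef i z.1 * ma_coef j z.2.
pose L := [seq (q, r) | q <- ma_index A, r <- ma_index A].
have VE w : \sum_(t <- Xi) (finite_ma A (t + k) i w * finite_ma A t j w -
    finite_autocov A k i j) = \sum_(z <- L) c z * V z w.
  under eq_bigr do rewrite finite_ma_product.
  rewrite exchange_big [RHS]big_allpairs; apply: eq_bigr => q _.
  rewrite exchange_big; apply: eq_bigr => r _.
  by rewrite -mulr_sumr.
under eq_Rintegral do rewrite VE.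
have VB z : \int[P]_w (V z w) ^+ 2 <= B * (size Xi)%:R.
  by rewrite mulrC; apply: noise_product_sum.
have sV z : sqint P (V z).
  by apply: sqint_sum => t; exact: noise_product_sqint e_noise _ _ _ _ _.
apply: le_trans (wsum_sqint_le (s := L) c sV (fun z _ => VB z)) _.
rewrite -mulrA ler_wpM2r ?mulr_ge0//.
rewrite (exprM S 2 2) ler_pXn2r ?nnegrE ?sqr_ge0 ?sumr_ge0//.
have -> : \sum_(z <- L) `|c z| =
    (\sum_(q <- ma_index A) `|ma_coef i q|) * (\sum_(r <- ma_index A) `|ma_coef j r|).
  rewrite [LHS]big_allpairs mulr_suml; apply: eq_bigr => q _.
  by rewrite mulr_sumr; apply: eq_bigr => r _; rewrite normrM.
by rewrite expr2 ler_pM// sumr_ge0.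
Qed.

End moving_average_moments.

(** * Passage to the limit *)

(** Continuity of the product from L^2 x L^2 to L^1. With [a = X - X'] and [b = Y - Y'], one has
    [X Y - X' Y' = Y a + X b - a b]. Young's inequality puts a small weight [del] on the fixed [X],
    [Y] and the large weight [1 / del] on [a], [b]. *)
Lemma L1_product_approx (disp : measure_display) (T : measurableType disp)
    (R : realType) (P : probability T R) (X Y : T -> R) (eps : R) :
  sqint P X -> sqint P Y -> 0 < eps ->
  exists2 eta : R, 0 < eta & forall X' Y' : T -> R,
    sqint P X' -> sqint P Y' ->
    \int[P]_w (X w - X' w) ^+ 2 <= eta -> \int[P]_w (Y w - Y' w) ^+ 2 <= eta ->
    \int[P]_w `|X w * Y w - X' w * Y' w| <= eps.
Proof.
move=> sX sY eps0.
have [_ iX] := sX; have [_ iY] := sY.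
pose K := \int[P]_w X w ^+ 2 + \int[P]_w Y w ^+ 2 + 1.
have K0 : 0 < K.
  by rewrite ltr_wpDl// addr_ge0//; apply: Rintegral_ge0 => w _; rewrite sqr_ge0.
pose del := eps / (2 * K).
have del0 : 0 < del by rewrite divr_gt0// mulr_gt0.
have dK : del * K = eps / 2 by rewrite /del; field; rewrite gt_eqF.
(* [1 / del] comes from Young's inequality, 1 from [|a b| <= a^2 + b^2]. With [eta = eps / (4 c)]
   the two errors cost [eps / 2] together. *)
pose c := del^-1 + 1.
have c0 : 0 < c by rewrite addr_gt0// invr_gt0.
exists (eps / (4 * c)); first by rewrite divr_gt0// mulr_gt0.
move=> X' Y' sX' sY' Xeta Yeta.
have sa := sqintB sX sX'; have sb := sqintB sY sY'.
have [_ ia] := sa; have [_ ib] := sb.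
have i1 := integrableZ_EFin del (integrableD_EFin iX iY).
have i2 := integrableZ_EFin c (integrableD_EFin ia ib).
have iL : P.-integrable setT (EFin \o (fun w => X w * Y w - X' w * Y' w)).
  have := integrableD_EFin (sqintM sX sY) (integrableZ_EFin (-1) (sqintM sX' sY')).
  by apply: eq_integrable => // w _ /=; congr EFin; ring.
apply: (@le_trans _ _ (\int[P]_w (del * (X w ^+ 2 + Y w ^+ 2) +
    c * ((X w - X' w) ^+ 2 + (Y w - Y' w) ^+ 2)))).
  apply: le_Rintegral => //; first exact: integrable_norm.
    exact: integrableD_EFin.
  move=> w _.
  pose x := X w; pose z := Y w; pose a := x - X' w; pose b := z - Y' w.
  have young u v : `|u * v| <= del * u ^+ 2 + del^-1 * v ^+ 2.
    have du : del * del^-1 = 1 by rewrite divff// gt_eqF.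
    have u2 : u ^+ 2 = `|u| ^+ 2 by rewrite real_normK ?num_real.
    have v2 : v ^+ 2 = `|v| ^+ 2 by rewrite real_normK ?num_real.
    rewrite normrM u2 v2; have := normr_ge0 u; have := normr_ge0 v.
    move: `|u| `|v| => {u2 v2} {}u {}v v0 u0.
    rewrite -(@ler_pM2l _ del)//.
    rewrite mulrDr [del * (_^-1 * _)]mulrA du mul1r.
    have := sqr_ge0 (del * u - v); have := mulr_ge0 u0 v0.
    have := mulr_ge0 (ltW del0) (mulr_ge0 u0 v0); lra.
  have h1 := young z a; have h2 := young x b.
  have h3 : `|a * b| <= a ^+ 2 + b ^+ 2.
    rewrite normrM -(real_normK (num_real a)) -(real_normK (num_real b)).
    have := normr_ge0 a; have := normr_ge0 b; move: `|a| `|b| => u v v0 u0.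
    by have := sqr_ge0 (u - v); have := mulr_ge0 u0 v0; lra.
  have -> : X w * Y w - X' w * Y' w = z * a + x * b - a * b.
    by rewrite /a /b /x /z; ring.
  apply: (le_trans (ler_normB _ _)).
  apply: (le_trans (lerD (ler_normD _ _) (lexx _))).
  rewrite -/x -/z -/a -/b /c; move: h1 h2 h3.
  by move: `|z * a| `|x * b| `|a * b| => n1 n2 n3; lra.
rewrite RintegralD// !RintegralZl//; [|exact: integrableD_EFin..].
rewrite !RintegralD//.
have h1 : del * (\int[P]_w X w ^+ 2 + \int[P]_w Y w ^+ 2) <= eps / 2.
  by rewrite -dK (ler_wpM2l (ltW del0))// /K lerDl.
have h2 : c * (\int[P]_w (X w - X' w) ^+ 2 + \int[P]_w (Y w - Y' w) ^+ 2) <= eps / 2.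
  apply: (@le_trans _ _ (c * (eps / (4 * c) + eps / (4 * c)))).
    by rewrite (ler_wpM2l (ltW c0))// lerD.
  by rewrite le_eqVlt; apply/orP; left; apply/eqP; field; rewrite gt_eqF.
by rewrite (le_trans (lerD h1 h2))//; lra.
Qed.

Lemma outerE (T : Type) (R : realType) (d m : nat) (y : Zlat d -> T -> 'cV[R]_m)
    k t w i j : outer y k t w i j = y (t + k) w i 0 * y t w j 0.
Proof. by rewrite mxE big_ord1 mxE; congr (_ * _); rewrite ord1. Qed.

Section moving_average_limit.
Context (disp : measure_display) (T : measurableType disp) (R : realType).
Context (P : probability T R) (d m p : nat).
Variables (M : Zlat d -> 'M[R]_(m, p)) (e : Zlat d -> T -> 'cV[R]_p).
Variables (y : Zlat d -> T -> 'cV[R]_m).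
Hypothesis M_summable : (\esum_(s in [set: Zlat d]) (frobenius (M s))%:E < +oo)%E.
Hypothesis e_noise : white_gaussian_noise P e.
Hypothesis y_ma : moving_average P M e y.
Implicit Types (A : {fset Zlat d}) (k t : Zlat d) (i j : 'I_m).

Let Y t i (w : T) := y t w i 0.

(** A coordinate of the error is at most its Frobenius norm, so mean-square convergence passes to
    coordinates. Finiteness of the bound makes the error square integrable, from which the square
    integrability of [y] follows. *)
Lemma ma_near t (eta : R) : 0 < eta ->
  \forall A \near @summability.totally (Zlat d), forall i,
    sqint P (fun w => y t w i 0 - finite_ma M e A t i w) /\
    \int[P]_w (y t w i 0 - finite_ma M e A t i w) ^+ 2 <= eta.
Proof.
move=> eta0; have [my cy] := y_ma t.
have eE : (0 < eta%:E)%E by rewrite lte_fin.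
have := cy _ (open_ereal_lt' eE); rewrite /= /nbhs/=; apply: filterS => A /= EA i.
have mD i0 : measurable_fun setT (fun w => y t w i0 0 - finite_ma M e A t i0 w).
  apply: measurable_funB; first exact: my.
  by case: (finite_ma_sqint M e_noise A t i0).
have h : (\int[P]_w ((y t w i 0 - finite_ma M e A t i w) ^+ 2)%:E <= eta%:E)%E.
  apply: le_trans (ltW EA); rewrite unlock; apply: ge0_le_integral => //.
  - by move=> w _; rewrite lee_fin sqr_ge0.
  - by apply/measurable_EFinP; exact: measurable_funX.
  - apply/measurable_EFinP; under eq_fun do rewrite frobenius_sqr.
    apply: measurable_sum => i0; apply: measurable_sum => j0.
    apply: measurable_funX; rewrite ord1.
    under eq_fun do rewrite mxE [X in _ + X]mxE partial_sum_entry.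
    exact: mD.
  - move=> w _; rewrite lee_fin.
    have := entry_sqr_le_frobenius (y t w -
      summability.partial_sum (fun s => M s *m e (t - s) w) A) i 0.
    by rewrite mxE [X in _ + X]mxE partial_sum_entry.
have iD : P.-integrable setT
    (EFin \o (fun w => (y t w i 0 - finite_ma M e A t i w) ^+ 2)).
  apply/integrableP; split; first by apply/measurable_EFinP; exact: measurable_funX.
  under eq_integral do rewrite /= ger0_norm ?sqr_ge0//.
  exact: le_lt_trans h (ltry _).
by split=> //; rewrite -lee_fin /Rintegral fineK// integrable_fin_num.
Qed.

Lemma ma_sqint t i : sqint P (Y t i).
Proof.
have [A /(_ i)[sD _]] := filter_ex (ma_near t ltr01).
have := sqintD sD (finite_ma_sqint M e_noise A t i).
by congr sqint; apply/funext => w; rewrite subrK.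
Qed.

Lemma ma_product_near k t (eps : R) : 0 < eps ->
  \forall A \near @summability.totally (Zlat d), forall i j,
    \int[P]_w `|Y (t + k) i w * Y t j w -
      finite_ma M e A (t + k) i w * finite_ma M e A t j w| <= eps.
Proof.
move=> eps0.
suff h i : \forall A \near @summability.totally (Zlat d), forall j,
    \int[P]_w `|Y (t + k) i w * Y t j w -
      finite_ma M e A (t + k) i w * finite_ma M e A t j w| <= eps.
  by apply: filter_forall.
apply: filter_forall => j.
have [eta eta0 h] := L1_product_approx (ma_sqint (t + k) i) (ma_sqint t j) eps0.
near=> A; apply: h; [exact: finite_ma_sqint|exact: finite_ma_sqint| |].
- suff /(_ i)[] : forall i,
    sqint P (fun w => y (t + k) w i 0 - finite_ma M e A (t + k) i w) /\
    \int[P]_w (y (t + k) w i 0 - finite_ma M e A (t + k) i w) ^+ 2 <= eta by [].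
  by near: A; exact: ma_near.
- suff /(_ j)[] : forall i,
    sqint P (fun w => y t w i 0 - finite_ma M e A t i w) /\
    \int[P]_w (y t w i 0 - finite_ma M e A t i w) ^+ 2 <= eta by [].
  by near: A; exact: ma_near.
Unshelve. all: by end_near. Qed.

Let product_diff_integrable A k t i j : P.-integrable setT (EFin \o (fun w =>
  Y (t + k) i w * Y t j w - finite_ma M e A (t + k) i w * finite_ma M e A t j w)).
Proof.
have := integrableD_EFin (sqintM (ma_sqint (t + k) i) (ma_sqint t j))
  (integrableZ_EFin (-1) (sqintM (finite_ma_sqint M e_noise A (t + k) i)
  (finite_ma_sqint M e_noise A t j))).
by apply: eq_integrable => // w _ /=; congr EFin; ring.
Qed.

Lemma ma_autocov_near k t (eps : R) : 0 < eps ->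
  \forall A \near @summability.totally (Zlat d), forall i j,
    `|\int[P]_w (Y (t + k) i w * Y t j w) - finite_autocov M A k i j| <= eps.
Proof.
move=> eps0; apply: filterS (ma_product_near k t eps0) => A h i j.
apply: le_trans (h i j); rewrite -(finite_ma_autocov M e_noise A k t i j).
rewrite -RintegralB//; first exact: le_normr_Rintegral.
- exact: sqintM (ma_sqint _ _) (ma_sqint _ _).
- by apply: sqintM; exact: finite_ma_sqint.
Qed.

Lemma autocovE k i j : autocov P y k i j = \int[P]_w (Y (0 + k) i w * Y 0 j w).
Proof.
by rewrite mxE unlock /Rintegral; congr fine; apply: eq_integral => w _; rewrite outerE.
Qed.

(** Stationarity: one and the same [A] approximates the moments at [t] and at 0 by [finite_autocov],
    which does not involve [t]. *)
Lemma ma_autocov k t i j :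
  \int[P]_w (Y (t + k) i w * Y t j w) = autocov P y k i j.
Proof.
rewrite autocovE; apply/eqP; rewrite -subr_eq0 -normr_le0.
apply/ler_addgt0Pr => eps eps0; rewrite [leRHS]add0r.
have e2 : 0 < eps / 2 by rewrite divr_gt0.
have [A [hA hA0]] := filter_ex (filterI (ma_autocov_near k t e2)
  (ma_autocov_near k 0 e2)).
apply: le_trans (ler_distD (finite_autocov M A k i j) _ _) _.
rewrite [leRHS]splitr; apply: lerD; first exact: hA.
by rewrite distrC; exact: hA0.
Qed.

Lemma expectation_outer k t i j :
  ('E_P[fun w => outer y k t w i j] = (autocov P y k i j)%:E)%E.
Proof.
rewrite -(ma_autocov k t) -expectation_Rintegral; last first.
  exact: sqintM (ma_sqint _ _) (ma_sqint _ _).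
by congr expectation; apply/funext => w; rewrite outerE.
Qed.

Lemma autocov_near k (eps : R) : 0 < eps ->
  \forall A \near @summability.totally (Zlat d), forall i j,
    `|autocov P y k i j - finite_autocov M A k i j| <= eps.
Proof.
move=> eps0; apply: filterS (ma_autocov_near k 0 eps0) => A h i j.
by rewrite -(ma_autocov k 0).
Qed.

(** The approximating [A] depends on [K], but the bound for [finite_autocov] does not, so it
    survives the limit. *)
Lemma autocov_summable : exists S : R, forall (K : seq (Zlat d)) i j, uniq K ->
  \sum_(k <- K) `|autocov P y k i j| <= S.
Proof.
have [S S0 SA] := ma_coef_bound M_summable.
exists (S ^+ 2) => K i j uK; apply/ler_addgt0Pr => eps eps0.
have e1 : 0 < eps / (size K).+1%:R by rewrite divr_gt0.
have [A hA] := filter_ex (near_all_seq _ K (fun k => autocov_near k e1)).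
apply: (@le_trans _ _ (\sum_(k <- K) (`|finite_autocov M A k i j| +
    eps / (size K).+1%:R))).
  rewrite big_seq [leRHS]big_seq; apply: ler_sum => k kK.
  by rewrite -lerBlDl (le_trans (lerB_dist _ _))// hA.
rewrite big_split/= lerD//; first exact: finite_autocov_summable.
rewrite big_const_seq count_predT iter_addr_0 -[_ *+ size K]mulr_natr mulrAC.
by rewrite ler_pdivrMr// (ler_wpM2l (ltW _))// ler_nat.
Qed.

(** The variance bound for finite moving averages is uniform in [A], and the products converge in
    L^1; [sqint_L1_limit] yields both the square integrability of the sum and the bound. *)
Lemma ma_variance : exists2 C : R, 0 <= C &
  forall (Xi : seq (Zlat d)) k i j, uniq Xi ->
  let Z w := \sum_(t <- Xi) (Y (t + k) i w * Y t j w - autocov P y k i j) in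
  sqint P Z /\ \int[P]_w (Z w) ^+ 2 <= C * (size Xi)%:R.
Proof.
have [S S0 SA] := ma_coef_bound M_summable.
have [B B0 nB] := noise_product_bound e_noise.
exists (S ^+ 4 * B); first by rewrite mulr_ge0// exprn_ge0.
move=> Xi k i j uXi Z; apply: sqint_L1_limit.
  apply: integrable_measurable_fun; apply: integrable_sum_EFin => t.
  have := integrableD_EFin (sqintM (ma_sqint (t + k) i) (ma_sqint t j))
    (integrable_cst_EFin P (- autocov P y k i j)).
  exact.
move=> eta eta0.
(* Each [t] spends this amount twice, on the product and on its mean; the successor allows [Xi] to
   be empty. *)
have e1 : 0 < eta / (2 * (size Xi).+1%:R) by rewrite divr_gt0// mulr_gt0.
have [A [hA hA']] := filter_ex (filterI
  (near_all_seq _ Xi (fun t => ma_product_near k t e1)) (autocov_near k e1)).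
pose ZA w := \sum_(t <- Xi)
  (finite_ma M e A (t + k) i w * finite_ma M e A t j w - finite_autocov M A k i j).
exists ZA.
  apply: sqint_sum => t; under eq_fun do rewrite finite_ma_product.
  apply: sqint_sum => q; apply: sqint_sum => r; apply: sqintZ.
  exact: noise_product_sqint e_noise _ _ _ _ _.
split; first by apply: (finite_ma_variance e_noise) => // i'; exact: SA.
pose D t w := `|Y (t + k) i w * Y t j w -
  finite_ma M e A (t + k) i w * finite_ma M e A t j w|.
have iD t : P.-integrable setT (EFin \o (fun w => D t w + eta / (2 * (size Xi).+1%:R))).
  by apply: integrableD_EFin (integrable_cst_EFin _ _); apply: integrable_norm.
have iDs := integrable_sum_EFin Xi iD.
have ZD w : `|Z w - ZA w| <= \sum_(t <- Xi) (D t w + eta / (2 * (size Xi).+1%:R)).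
  rewrite /Z /ZA -sumrB; apply: le_trans (ler_norm_sum _ _ _) _.
  apply: ler_sum => t _; rewrite /D.
  rewrite [X in `|X|](_ : _ = (Y (t + k) i w * Y t j w -
    finite_ma M e A (t + k) i w * finite_ma M e A t j w) -
    (autocov P y k i j - finite_autocov M A k i j)); last by ring.
  by rewrite (le_trans (ler_normB _ _))// lerD.
have mZ : measurable_fun setT (fun w => `|Z w - ZA w|).
  apply: measurableT_comp => //; apply: measurable_funB.
    apply: measurable_sum => t; apply: measurable_funB => //.
    by apply: measurable_funM; [case: (ma_sqint (t + k) i)|case: (ma_sqint t j)].
  apply: measurable_sum => t; apply: measurable_funB => //.
  by apply: measurable_funM; [case: (finite_ma_sqint M e_noise A (t + k) i)|
    case: (finite_ma_sqint M e_noise A t j)].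
apply: (@le_trans _ _ (\int[P]_w (\sum_(t <- Xi)
    (D t w + eta / (2 * (size Xi).+1%:R)))%:E)%E).
  apply: ge0_le_integral => //.
  - by apply/measurable_EFinP.
  - exact: measurable_int iDs.
  - by move=> w _; rewrite lee_fin; exact: ZD.
rewrite [X in (X <= _)%E](_ : _ = (\int[P]_w \sum_(t <- Xi)
    (D t w + eta / (2 * (size Xi).+1%:R)))%:E); last first.
  by rewrite /Rintegral fineK// integrable_fin_num.
rewrite lee_fin Rintegral_sum//.
apply: (@le_trans _ _ (\sum_(t <- Xi) (eta / (2 * (size Xi).+1%:R) +
    eta / (2 * (size Xi).+1%:R)))).
  rewrite big_seq [leRHS]big_seq; apply: ler_sum => t tXi.
  rewrite RintegralD//; [|by apply: integrable_norm|exact: integrable_cst_EFin].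
  by rewrite Rintegral_prob_cst lerD// hA.
rewrite big_const_seq count_predT iter_addr_0 -[_ *+ size Xi]mulr_natr.
rewrite (_ : _ + _ = eta / (size Xi).+1%:R); last by field.
by rewrite mulrAC ler_pdivrMr// (ler_wpM2l (ltW _))// ler_nat.
Qed.

End moving_average_limit.

(** * Index boxes and absolutely summable families *)

Section box.
Variables (d : nat).
Implicit Types (c x k : Zlat d) (L n N : nat).

Definition box_point c L (g : {ffun 'I_d -> 'I_L}) : Zlat d :=
  [ffun j => c j + (g j : nat)%:Z].

(** The half-open cube with corner [c] and side [L], presented as an injective image of a function
    space so that its cardinality is immediate. *)
Definition box c L : {fset Zlat d} :=
  [fset box_point c g | g in [set: {ffun 'I_d -> 'I_L}]%SET]%fset.

Lemma in_boxP c L x : reflect (forall j, c j <= x j < c j + L%:Z) (x \in box c L).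
Proof.
apply: (iffP (imfsetP _ _ _ _)) => [[g _ ->] j|h].
  by rewrite /box_point ffunE lerDl ltrD2l ltz_nat ltn_ord.
have hL j : (`|x j - c j| < L)%N by have := h j; lia.
exists [ffun j => Ordinal (hL j)]; first by rewrite finset.in_setT.
by apply/ffunP => j; rewrite !ffunE /=; have := h j; lia.
Qed.

Lemma card_box c L : #|` box c L| = (L ^ d)%N.
Proof.
rewrite card_imfset/=; last first.
  move=> g h /ffunP gh; apply/ffunP => j; apply: val_inj.
  by have := gh j; rewrite !ffunE => /addrI[].
by rewrite -cardE cardsT card_ffun !card_ord.
Qed.

Lemma LambdaE n : Lambda n = [set` box [ffun=> - n%:Z] (2 * n + 1)].
Proof.
apply/seteqP; split=> k /=.
  by move=> h; apply/in_boxP => j; rewrite ffunE; have := h j; lia.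
by move=> /in_boxP h j; have := h j; rewrite ffunE; lia.
Qed.

Lemma finite_Lambda n : finite_set (@Lambda d n).
Proof. by rewrite LambdaE; exact: finite_fset. Qed.

Lemma card_Lambda n : #|` fset_set (@Lambda d n)| = ((2 * n + 1) ^ d)%N.
Proof. by rewrite LambdaE set_fsetK card_box. Qed.

Lemma finite_Xi N k : finite_set (Xi N k).
Proof.
apply: (@sub_finite_set _ _ [set` box [ffun=> 1] N]); last exact: finite_fset.
move=> t h; apply/in_boxP => j; rewrite ffunE.
by have := h j; case: ifP; lia.
Qed.

(** In direction [j] the box starts at 1, or at [1 - k j] for negative [k j], and has side
    [N - |k j|]; the cube of side [N - n] at that corner fits inside. *)
Lemma card_Xi_ge N n k : Lambda n k -> ((N - n) ^ d <= #|` fset_set (Xi N k)|)%N.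
Proof.
move=> kn; pose c : Zlat d := [ffun j => if 0 <= k j then 1 else 1 - k j].
rewrite -(card_box c); apply: fsubset_leq_card; apply/fsubsetP => t /in_boxP h.
rewrite in_fset_set; last exact: finite_Xi.
rewrite inE => j; have := h j; have := kn j; rewrite ffunE.
by case: ifP; lia.
Qed.

End box.

(** * Absolutely summable families with bounded weights *)

Section absolutely_summable.
Context (R : realType) (I : choiceType) (a : I -> R) (S : R).
Hypothesis aS : forall K : seq I, uniq K -> \sum_(k <- K) `|a k| <= S.

Let psum (c : I -> R) (A : {fset I}) : R := \sum_(k <- A) a k * c k.

(** [A0] nearly attains the supremum of the finite sums of [|a k|], so what lies outside it is small
    for all weights bounded by 1 at once. This uniformity in [c] becomes uniformity in theta. *)
Lemma summable_tail (eps : R) : 0 < eps -> exists A0 : {fset I},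
  forall c : I -> R, (forall k, `|c k| <= 1) ->
  forall A : {fset I}, (A0 `<=` A)%fset -> `|psum c A - psum c A0| <= eps.
Proof.
move=> eps0.
pose E := [set x | exists A : {fset I}, x = \sum_(k <- A) `|a k|].
have supE : has_sup E.
  split; first by exists (\sum_(k <- fset0) `|a k|), fset0.
  by exists S => _ [A ->]; apply: aS; exact: fset_uniq.
have [_ [A0 ->] hA0] := sup_adherent eps0 supE.
exists A0 => c c1 A A0A.
pose B : {fset I} := [fset x in A | x \notin A0]%fset.
have split_sum (f : I -> R) :
    \sum_(k <- A) f k = \sum_(k <- A0) f k + \sum_(k <- B) f k.
  rewrite (big_fsetID _ (mem A0)); congr (_ + _); apply: eq_fbigl => x.
  rewrite !inE/= andbC; case: (boolP (x \in A0)) => //= xA0.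
  exact: (fsubsetP A0A).
rewrite /psum split_sum addrC addKr.
apply: le_trans (ler_norm_sum _ _ _) _.
apply: (@le_trans _ _ (\sum_(k <- B) `|a k|)).
  by apply: ler_sum => k _; rewrite normrM ler_piMr.
have : \sum_(k <- A) `|a k| <= sup E by apply: ub_le_sup; [case: supE|exists A].
by rewrite split_sum; lra.
Qed.

Lemma absolutely_summable_cvg (c : I -> R) : (forall k, `|c k| <= 1) ->
  exists l : R, psum c @ summability.totally --> l.
Proof.
move=> c1; apply/cvg_ex; apply: cauchy_cvg; apply: cauchy_exP => eps eps0.
have e2 : 0 < eps / 2 by rewrite divr_gt0.
have [A0 h] := summable_tail e2.
exists (psum c A0); exists A0 => // A /= /(h _ c1) hA.
by rewrite -ball_normE/= distrC (le_lt_trans hA)//; lra.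
Qed.

(** The limit is compared with the partial sum over some larger [B], and both [A] and [B] with [A0].
    The set [A0] is still chosen before [c] and [l]. *)
Lemma summable_limit_tail (eps : R) : 0 < eps -> exists A0 : {fset I},
  forall (c : I -> R) (l : R), (forall k, `|c k| <= 1) ->
  psum c @ summability.totally --> l ->
  forall A : {fset I}, (A0 `<=` A)%fset -> `|l - psum c A| <= eps.
Proof.
move=> eps0; have e2 : 0 < eps / 2 by rewrite divr_gt0.
have [A0 h] := summable_tail e2.
exists A0 => c l c1 /cvgrPdist_lt cl A A0A; apply/ler_addgt0Pr => del del0.
have A0B : \forall B \near summability.totally, (A0 `<=` B)%fset by exists A0.
have [B [hB BA]] := filter_ex (filterI (cl _ del0) A0B).
have := h c c1 A A0A; have := h c c1 B BA; have := hB.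
move: (psum c A0) (psum c A) (psum c B) => x0 x1 x2.
by rewrite !ltr_norml !ler_norml; lra.
Qed.

End absolutely_summable.

Lemma complex_sum_parts (R : realType) (I : choiceType) (a c1 c2 : I -> R) (S : R) :
  (forall K : seq I, uniq K -> \sum_(k <- K) `|a k| <= S) ->
  (forall k, `|c1 k| <= 1) -> (forall k, `|c2 k| <= 1) ->
  exists l1 l2 : R,
  [/\ @summability.sum I R[i] R[i]^o (fun k => (a k)%:C%C * (c1 k +i* c2 k)%C) =
        (l1 +i* l2)%C,
      (fun A : {fset I} => \sum_(k <- A) a k * c1 k) @ summability.totally --> l1 &
      (fun A : {fset I} => \sum_(k <- A) a k * c2 k) @ summability.totally --> l2].
Proof.
move=> aS h1 h2.
have [l1 cl1] := absolutely_summable_cvg aS h1; have [l2 cl2] := absolutely_summable_cvg aS h2.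
exists l1, l2; split=> //.
apply: cvg_lim; first exact: norm_hausdorff.
apply/cvgrPdist_lt => /= eps eps0.
(* The norm of [R[i]] has values in [R[i]]; a positive [eps] there is real and is replaced by its
   real part. *)
have epsE : eps = (complex.Re eps)%:C%C.
  by apply/esym/RRe_real/gtr0_real.
have e0 : 0 < complex.Re eps by move: eps0; rewrite {1}epsE ltcR.
have e2 : 0 < complex.Re eps / 2 by rewrite divr_gt0.
move/cvgrPdist_lt : cl1 => /(_ _ e2) n1; move/cvgrPdist_lt : cl2 => /(_ _ e2) n2.
near=> A.
have d1 : `|l1 - \sum_(k <- A) a k * c1 k| < complex.Re eps / 2 by near: A.
have d2 : `|l2 - \sum_(k <- A) a k * c2 k| < complex.Re eps / 2 by near: A.
have -> : summability.partial_sum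
    (fun k => (a k)%:C%C * (c1 k +i* c2 k)%C : R[i]^o) A =
    ((\sum_(k <- A) a k * c1 k) +i* (\sum_(k <- A) a k * c2 k))%C.
  rewrite /summability.partial_sum
    -(big_seq_fsetE _ _ predT (fun k => (a k)%:C%C * (c1 k +i* c2 k)%C : R[i]^o)).
  elim/big_rec3 : _ => // k x1 x2 _ _ ->.
  by apply/eqP; rewrite eq_complex /= !mul0r subr0 addr0 !eqxx.
set x1 := \sum_(k <- A) _ in d1 *; set x2 := \sum_(k <- A) _ in d2 *.
rewrite [X in _ < X]epsE.
have -> : (l1 +i* l2)%C - (x1 +i* x2)%C = ((l1 - x1) +i* (l2 - x2))%C :> R[i] by [].
rewrite normc_def ltcR /=.
apply: (@le_lt_trans _ _ (`|l1 - x1| + `|l2 - x2|)); last by lra.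
rewrite -[leRHS]ger0_norm ?addr_ge0// -sqrtr_sqr ler_sqrt ?sqr_ge0//.
rewrite -(real_normK (num_real (l1 - x1))) -(real_normK (num_real (l2 - x2))).
have := mulr_ge0 (normr_ge0 (l1 - x1)) (normr_ge0 (l2 - x2)).
by move: `|l1 - x1| `|l2 - x2| => u v; lra.
Unshelve. all: by end_near. Qed.

(** * The truncated periodogram *)

Section periodogram.
Context (disp : measure_display) (T : measurableType disp) (R : realType).
Context (P : probability T R) (d m p : nat).
Variables (M : Zlat d -> 'M[R]_(m, p)) (e : Zlat d -> T -> 'cV[R]_p).
Variables (y : Zlat d -> T -> 'cV[R]_m).
Hypothesis M_summable : (\esum_(s in [set: Zlat d]) (frobenius (M s))%:E < +oo)%E.
Hypothesis e_noise : white_gaussian_noise P e.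
Hypothesis y_ma : moving_average P M e y.
Implicit Types (k t : Zlat d) (i j : 'I_m) (theta : 'I_d -> R).

Let co theta k := cos (- pairing k theta).
Let si theta k := sin (- pairing k theta).

(** Cosines and sines are weights bounded by 1, so [A0] can be chosen before theta; it is the union
    of the sets obtained for the finitely many entries. *)
Lemma spectral_density_tail (eps : R) : 0 < eps ->
  exists A0 : {fset Zlat d}, forall theta (A : {fset Zlat d}) i j,
    (A0 `<=` A)%fset -> exists t1 t2 : R, [/\ `|t1| <= eps, `|t2| <= eps &
    spectral_density P y theta i j =
      ((\sum_(k <- A) autocov P y k i j * co theta k + t1) +i*
       (\sum_(k <- A) autocov P y k i j * si theta k + t2))%C].
Proof.
move=> eps0; have [S aS] := autocov_summable M_summable e_noise y_ma.
have h i j := summable_limit_tail (fun K uK => aS K i j uK) eps0.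
pose A_ i j : {fset Zlat d} := projT1 (cid (h i j)).
pose A0 : {fset Zlat d} := 
    (\bigcup_(z <- index_enum ('I_m * 'I_m)%type) A_ z.1 z.2)%fset.
exists A0 => theta A i j A0A.
have AA : (A_ i j `<=` A)%fset.
  apply: fsubset_trans A0A.
  exact: (bigfcup_sup (fun z => A_ z.1 z.2) (mem_index_enum (i, j))).
have tail := projT2 (cid (h i j)).
have co1 k : `|co theta k| <= 1 by exact: cos_max.
have si1 k : `|si theta k| <= 1 by exact: sin_max.
have [l1 [l2 [lE cl1 cl2]]] := complex_sum_parts (fun K uK => aS K i j uK) co1 si1.
exists (l1 - \sum_(k <- A) autocov P y k i j * co theta k),
  (l2 - \sum_(k <- A) autocov P y k i j * si theta k); split.
- exact: tail co1 cl1 _ AA.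
- exact: tail si1 cl2 _ AA.
- by rewrite mxE !subrKC -lE.
Qed.

Lemma truncated_periodogram_entry N n theta w i j :
  truncated_periodogram y N n theta w i j =
  ((\sum_(k <- fset_set (Lambda n)) co theta k * autocov_est y N k w i j) +i*
   (\sum_(k <- fset_set (Lambda n)) si theta k * autocov_est y N k w i j))%C.
Proof.
rewrite /truncated_periodogram fsbig_finite; last exact: finite_Lambda.
rewrite summxE; elim/big_rec3 : _ => // k x1 x2 x3 _ ->.
by rewrite !mxE; apply/eqP; rewrite eq_complex/= !mulr0 subr0 add0r !eqxx.
Qed.

Lemma autocov_est_entry N k w i j :
  autocov_est y N k w i j = (#|` fset_set (Xi N k)|%:R)^-1 *
    \sum_(t <- fset_set (Xi N k)) y (t + k) w i 0 * y t w j 0.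
Proof.
rewrite mxE fsbig_finite; last exact: finite_Xi.
by rewrite summxE; congr (_ * _); apply: eq_bigr => t _; rewrite outerE.
Qed.

Lemma cfrobenius_sqr (A : 'M[R[i]]_m) :
  cfrobenius A ^+ 2 =
  \sum_(i < m) \sum_(j < m) (complex.Re (A i j) ^+ 2 + complex.Im (A i j) ^+ 2).
Proof.
rewrite sqr_sqrtr; last by do 2 apply: sumr_ge0 => ? _; rewrite sqr_ge0.
do 2 apply: eq_bigr => ? _; case: (A _ _) => a b /=.
by rewrite sqr_sqrtr// addr_ge0 ?sqr_ge0.
Qed.

(** Separates the truncation bias [t1] from the random fluctuation by
    [(t1 - x)^2 <= 2 t1^2 + 2 x^2]. Different lags may be correlated, hence the factor [(size s)^2],
    which the slow growth of [f] compensates. *)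
Lemma affine_sum_sqint_le (I : eqType) (s : seq I) (c : I -> R)
    (Z : I -> T -> R) (t1 e1 B : R) :
  (forall h, sqint P (Z h)) -> (forall h, h \in s -> \int[P]_w (Z h w) ^+ 2 <= B) ->
  (forall h, `|c h| <= 1) -> 0 <= B -> `|t1| <= e1 ->
  sqint P (fun w => t1 - \sum_(h <- s) c h * Z h w) /\
  \int[P]_w (t1 - \sum_(h <- s) c h * Z h w) ^+ 2 <=
    2 * (e1 ^+ 2 + (size s)%:R ^+ 2 * B).
Proof.
move=> sZ ZB c1 B0 t1e.
have sS : sqint P (fun w => \sum_(h <- s) c h * Z h w).
  by apply: sqint_sum => h; exact: sqintZ.
have sD := sqintB (sqint_cst P t1) sS.
split=> //; have [_ iS] := sS; have [_ iD] := sD.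
have t2 : t1 ^+ 2 <= e1 ^+ 2.
  rewrite -(real_normK (num_real t1)) ler_pXn2r ?nnegrE//.
  exact: le_trans t1e.
apply: (@le_trans _ _ (\int[P]_w (2 * e1 ^+ 2 + 2 * (\sum_(h <- s) c h * Z h w) ^+ 2))).
  apply: le_Rintegral => //.
    by apply: integrableD_EFin (integrable_cst_EFin _ _) _; exact: integrableZ_EFin.
  move=> w _; move: (\sum_(h <- s) _) => x.
  by have := sqr_ge0 (t1 + x); lra.
rewrite RintegralD//; [|exact: integrable_cst_EFin|exact: integrableZ_EFin].
rewrite Rintegral_prob_cst RintegralZl// mulrDr lerD// ler_wpM2l//.
apply: le_trans (wsum_sqint_le c sZ ZB) _; rewrite ler_wpM2r//.
rewrite ler_pXn2r ?nnegrE ?sumr_ge0//.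
rewrite -[leRHS]mulr_natl -sum1_size natr_sum mulr_suml.
by apply: ler_sum => h _; rewrite mulr1.
Qed.

(** In each entry the [autocov] terms cancel, leaving a tail minus a weighted sum of centred
    estimation errors. Real and imaginary parts each contribute a factor 2, whence the 4. *)
Lemma periodogram_error (C e1 B : R) N n theta :
  (forall (Xi : seq (Zlat d)) k i j, uniq Xi ->
    let Z w := \sum_(t <- Xi) (y (t + k) w i 0 * y t w j 0 - autocov P y k i j) in
    sqint P Z /\ \int[P]_w (Z w) ^+ 2 <= C * (size Xi)%:R) ->
  0 <= C -> (n < N)%N ->
  (forall k, Lambda n k -> C / #|` fset_set (Xi N k)|%:R <= B) ->
  (forall i j, exists t1 t2 : R, [/\ `|t1| <= e1, `|t2| <= e1 &
    spectral_density P y theta i j =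
      ((\sum_(k <- fset_set (Lambda n)) autocov P y k i j * co theta k + t1) +i*
       (\sum_(k <- fset_set (Lambda n)) autocov P y k i j * si theta k + t2))%C]) ->
  ('E_P[fun w => (cfrobenius (spectral_density P y theta -
     truncated_periodogram y N n theta w) ^+ 2)%R] <=
   ((m * m)%:R * (4 * (e1 ^+ 2 + #|` fset_set (@Lambda d n)|%:R ^+ 2 * B)))%:E)%E.
Proof.
move=> varZ C0 nN CB tails.
(* Read off at the lag 0, which always lies in [Lambda n]. *)
have B0 : 0 <= B.
  apply: le_trans (CB 0 _); first by rewrite divr_ge0.
  by move=> j; rewrite ffunE normr0.
pose L : seq (Zlat d) := fset_set (@Lambda d n).
(* Nonemptiness makes the average of a constant equal to that constant; over an empty set the
   inverse of 0 would be 0. *)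
have Xi_gt0 k : k \in L -> (0 < #|` fset_set (Xi N k)|)%N.
  rewrite in_fset_set ?inE; last exact: finite_Lambda.
  move=> kn; apply: leq_trans (card_Xi_ge N kn).
  by rewrite expn_gt0 subn_gt0 nN.
pose Z i j k w := (#|` fset_set (Xi N k)|%:R)^-1 *
  \sum_(t <- fset_set (Xi N k)) (y (t + k) w i 0 * y t w j 0 - autocov P y k i j).
have sZ i j k : sqint P (Z i j k).
  by apply: sqintZ; have [] := varZ _ k i j (fset_uniq (fset_set (Xi N k))).
have ZB i j k : k \in L -> \int[P]_w (Z i j k w) ^+ 2 <= B.
  move=> kL; have [sW W] := varZ _ k i j (fset_uniq (fset_set (Xi N k))).
  have n0 : (0 : R) < #|` fset_set (Xi N k)|%:R by rewrite ltr0n Xi_gt0.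
  apply: le_trans (CB k _); last first.
    by move: kL; rewrite in_fset_set ?inE//; exact: finite_Lambda.
  under eq_Rintegral do rewrite exprMn.
  rewrite RintegralZl//; last by case: sW.
  rewrite exprVn ler_pdivrMl ?exprn_gt0//; apply: le_trans W _.
  by rewrite le_eqVlt; apply/orP; left; apply/eqP; field; rewrite gt_eqF.
have ZE i j k w : k \in L ->
    autocov_est y N k w i j = autocov P y k i j + Z i j k w.
  move=> kL; have n0 : (0 : R) < #|` fset_set (Xi N k)|%:R by rewrite ltr0n Xi_gt0.
  rewrite autocov_est_entry /Z sumrB mulrBr.
  rewrite [X in _ - _ * X](_ : _ = #|` fset_set (Xi N k)|%:R * autocov P y k i j).
    by rewrite mulKf ?gt_eqF// subrKC.
  by rewrite big_const_seq count_predT iter_addr_0 mulr_natl.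
have sumE (c : Zlat d -> R) (t : R) i j w :
    (\sum_(k <- L) autocov P y k i j * c k + t) -
    \sum_(k <- L) c k * autocov_est y N k w i j =
    t - \sum_(k <- L) c k * Z i j k w.
  have -> : \sum_(k <- L) c k * autocov_est y N k w i j =
      \sum_(k <- L) (autocov P y k i j * c k + c k * Z i j k w).
    by apply: eq_big_seq => k kL; rewrite ZE// mulrDr [c k * autocov _ _ _ _ _]mulrC.
  by rewrite big_split/= opprD addrA [_ + t]addrC addrK.
pose t1 i j := projT1 (cid (tails i j)).
pose t2 i j := projT1 (cid (projT2 (cid (tails i j)))).
have tE i j : [/\ `|t1 i j| <= e1, `|t2 i j| <= e1 &
    spectral_density P y theta i j =
      ((\sum_(k <- L) autocov P y k i j * co theta k + t1 i j) +i*
       (\sum_(k <- L) autocov P y k i j * si theta k + t2 i j))%C].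
  exact: projT2 (cid (projT2 (cid (tails i j)))).
pose U i j w := t1 i j - \sum_(k <- L) co theta k * Z i j k w.
pose V i j w := t2 i j - \sum_(k <- L) si theta k * Z i j k w.
have UP i j : sqint P (U i j) /\
    \int[P]_w (U i j w) ^+ 2 <= 2 * (e1 ^+ 2 + (size L)%:R ^+ 2 * B).
  apply: affine_sum_sqint_le => //; [exact: ZB|by move=> k; exact: cos_max|].
  by case: (tE i j).
have VP i j : sqint P (V i j) /\
    \int[P]_w (V i j w) ^+ 2 <= 2 * (e1 ^+ 2 + (size L)%:R ^+ 2 * B).
  apply: affine_sum_sqint_le => //; [exact: ZB|by move=> k; exact: sin_max|].
  by case: (tE i j).
have iU i j : P.-integrable setT (EFin \o (fun w => U i j w ^+ 2)).
  by case: (UP i j) => -[].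
have iV i j : P.-integrable setT (EFin \o (fun w => V i j w ^+ 2)).
  by case: (VP i j) => -[].
have -> : (fun w => cfrobenius (spectral_density P y theta -
     truncated_periodogram y N n theta w) ^+ 2) =
   (fun w => \sum_(i < m) \sum_(j < m) (U i j w ^+ 2 + V i j w ^+ 2)).
  apply/funext => w; rewrite cfrobenius_sqr; apply: eq_bigr => i _.
  apply: eq_bigr => j _; have [_ _ sE] := tE i j.
  have -> // : (spectral_density P y theta - truncated_periodogram y N n theta w) i j =
      (U i j w +i* V i j w)%C.
  by rewrite mxE [X in _ + X]mxE sE truncated_periodogram_entry /U /V -!sumE.
rewrite expectation_Rintegral; last first.
  by do 2 apply: integrable_sum_EFin => ?; exact: integrableD_EFin.
rewrite lee_fin Rintegral_sum; last first.
  by move=> i; apply: integrable_sum_EFin => j; exact: integrableD_EFin.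
have -> : (m * m)%:R * (4 * (e1 ^+ 2 + #|` fset_set (@Lambda d n)|%:R ^+ 2 * B)) =
    \sum_(i < m) \sum_(j < m) (4 * (e1 ^+ 2 + (size L)%:R ^+ 2 * B)).
  by rewrite !sumr_const card_ord -mulrnA mulr_natl.
apply: ler_sum => i _; rewrite Rintegral_sum; last by move=> j; exact: integrableD_EFin.
apply: ler_sum => j _; rewrite RintegralD//.
by have [_ hU] := UP i j; have [_ hV] := VP i j; lra.
Qed.

End periodogram.

(** The quantity is [C x^d] with [x = (2 f + 1)^2 / (N - f)], and [x^d <= x] because [x <= 1] and
    [d >= 1]. *)
Lemma truncation_rate (R : realType) (d : nat) (f : nat -> nat) (C q : R) :
  (0 < d)%N -> 0 <= C -> 0 < q ->
  f @ \oo --> \oo ->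
  (fun N : nat => (f N)%:R ^+ 2 / N%:R : R) @ \oo --> (0 : R) ->
  \forall N \near \oo, (f N < N)%N /\
    ((2 * f N + 1) ^ d)%:R ^+ 2 * (C / ((N - f N) ^ d)%:R) <= q.
Proof.
move=> d0 C0 q0 finf fslow.
(* Eventually [f^2 <= eta N], which leads to [x <= 18 eta]: 9 from [2 f + 1 <= 3 f], 2 from
   [N - f >= N / 2]. The first bound on [eta] gives [f <= N / 36] and [x <= 1], the second
   [C * 18 eta <= q]; [C + 1] avoids a division by 0. *)
pose eta := Num.min (36^-1) (q / (18 * (C + 1))).
have C10 : 0 < C + 1 by lra.
have eta0 : 0 < eta by rewrite lt_min invr_gt0 ltr0n/= divr_gt0// mulr_gt0.
have eta36 : eta <= 36^-1 by rewrite /eta ge_min lexx.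
have etaq : eta * (18 * (C + 1)) <= q.
  by rewrite -ler_pdivlMr ?mulr_gt0// /eta ge_min lexx orbT.
near=> N.
have N0 : (0 < N)%N by near: N; exact: nbhs_infty_gt.
have f1 : (1 <= f N)%N.
  by near: N; exact: (finf _ (nbhs_infty_ge 1)).
have fN : `|0 - (f N)%:R ^+ 2 / N%:R| < eta :> R.
  by near: N; move/cvgrPdist_lt : fslow; apply.
have NR : (0 : R) < N%:R by rewrite ltr0n.
have fR : (1 : R) <= (f N)%:R by rewrite ler1n.
have f2N : (f N)%:R ^+ 2 <= eta * N%:R :> R.
  rewrite -ler_pdivrMr//; move: fN; rewrite sub0r normrN.
  by move=> /(le_lt_trans (ler_norm _))/ltW.
have fhalf : (f N)%:R <= N%:R / 36 :> R.
  have : (f N)%:R <= (f N)%:R ^+ 2 :> R by rewrite expr2 ler_peMl//; lra.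
  have : eta * N%:R <= 36^-1 * N%:R by rewrite ler_wpM2r// ltW.
  lra.
have fltN : (f N < N)%N by rewrite -(ltr_nat R); lra.
split=> //.
have NfR : (N - f N)%:R = N%:R - (f N)%:R :> R by rewrite natrB// ltnW.
have Nf0 : (0 : R) < (N - f N)%:R by rewrite NfR; lra.
pose x : R := (2 * f N + 1)%:R ^+ 2 / (N - f N)%:R.
have -> : ((2 * f N + 1) ^ d)%:R ^+ 2 * (C / ((N - f N) ^ d)%:R) = C * x ^+ d.
  by rewrite /x !natrX expr_div_n exprAC mulrCA mulrA.
have x0 : 0 <= x by rewrite divr_ge0// sqr_ge0.
have x18 : x <= 18 * eta.
  rewrite /x ler_pdivrMr// NfR natrD natrM.
  have : (2 * (f N)%:R + 1) ^+ 2 <= (3 * (f N)%:R) ^+ 2 :> R.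
    by rewrite ler_pXn2r// ?nnegrE; lra.
  have : eta * (f N)%:R <= eta * (N%:R / 36) by rewrite ler_wpM2l// ltW.
  have : 0 < eta * N%:R by rewrite mulr_gt0.
  lra.
have x1 : x <= 1 by lra.
have xd : x ^+ d <= x by rewrite -[leRHS]expr1 ler_wiXn2l.
have : C * x ^+ d <= C * (18 * eta) by rewrite ler_wpM2l// (le_trans xd).
lra.
Unshelve. all: by end_near. Qed.

(** * Uniform mean-square consistency *)

Unset Implicit Arguments.

(** The first conjunct justifies the reference point 0 in [autocov]; in the second, the threshold
    for [N] precedes theta, which expresses the uniformity. *)
Theorem theorem2 (disp : measure_display) (T : measurableType disp)
    (R : realType) (P : probability T R) (d m p : nat)
    (d_gt0 : (0 < d)%N) (m_gt0 : (0 < m)%N) (p_gt0 : (0 < p)%N)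
    (M : Zlat d -> 'M[R]_(m, p))
    (M_summable : (\esum_(s in [set: Zlat d]) (frobenius (M s))%:E < +oo)%E)
    (e : Zlat d -> T -> 'cV[R]_p) (e_noise : white_gaussian_noise P e)
    (y : Zlat d -> T -> 'cV[R]_m) (y_ma : moving_average P M e y)
    (f : nat -> nat) (f_infty : f @ \oo --> \oo)
    (f_slow : (fun N : nat => (f N)%:R ^+ 2 / N%:R : R) @ \oo --> (0 : R)) :
  (forall (t k : Zlat d) (i j : 'I_m),
     ('E_P[fun w => outer y k t w i j])%E = (autocov P y k i j)%:E)
  /\
  (forall eps : R, 0 < eps ->
     \forall N \near \oo, forall theta : 'I_d -> R, torus theta ->
       ('E_P[fun w => (cfrobenius (spectral_density P y theta -
            truncated_periodogram y N (f N) theta w) ^+ 2)%R] < eps%:E)%E).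
Proof.
split=> [t k i j|eps eps0]; first exact: expectation_outer e_noise y_ma k t i j.
have mm0 : (0 : R) <= (m * m)%:R by [].
(* Squared bias and variance term are each made at most [q], so the error is at most
   [8 m^2 q < eps]; the added 1 makes the inequality strict. *)
pose q : R := eps / (16 * ((m * m)%:R + 1)).
have den0 : (0 : R) < 16 * ((m * m)%:R + 1) by lra.
have q0 : 0 < q by rewrite divr_gt0.
have qE : q * (16 * ((m * m)%:R + 1)) = eps by rewrite divfK// gt_eqF.
have [C C0 varZ] := ma_variance M_summable e_noise y_ma.
have sq0 : 0 < Num.sqrt q by rewrite sqrtr_gt0.
have [A0 tail] := spectral_density_tail M_summable e_noise y_ma sq0.
(* Since [f] tends to infinity, [Lambda (f N)] eventually contains the finite set [A0], and the tail
   bound applies to it. *)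
have A0f : \forall N \near \oo, forall k, k \in enum_fset A0 -> Lambda (f N) k.
  apply: near_all_seq => k.
  have : \forall N \near \oo, (\max_(j < d) `|k j|%N <= f N)%N.
    exact: (f_infty _ (nbhs_infty_ge _)).
  apply: filterS => N /= kN j.
  rewrite -abszE lez_nat; apply: leq_trans kN.
  exact: (leq_bigmax (F := fun j => `|k j|%N) j).
near=> N => theta _.
have [fN rate] : (f N < N)%N /\
    ((2 * f N + 1) ^ d)%:R ^+ 2 * (C / ((N - f N) ^ d)%:R) <= q.
  by near: N; exact: truncation_rate.
have A0N : (A0 `<=` fset_set (Lambda (f N)))%fset.
  apply/fsubsetP => k kA0; rewrite in_fset_set ?inE; last exact: finite_Lambda.
  by move: k kA0; near: N; exact: A0f.
have CB (k : Zlat d) : Lambda (f N) k ->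
    C / #|` fset_set (Xi N k)|%:R <= C / ((N - f N) ^ d)%:R.
  move=> kf; have le := card_Xi_ge N kf.
  have pos : (0 < (N - f N) ^ d)%N by rewrite expn_gt0 subn_gt0 fN.
  have pos' := leq_trans pos le.
  by rewrite ler_wpM2l// lef_pV2 ?posrE ?ltr0n// ler_nat.
apply: le_lt_trans (periodogram_error varZ C0 fN CB
  (fun i j => tail theta _ i j A0N)) _.
rewrite lte_fin sqr_sqrtr ?ltW// card_Lambda.
have : (m * m)%:R * (4 * (q + ((2 * f N + 1) ^ d)%:R ^+ 2 *
    (C / ((N - f N) ^ d)%:R))) <= (m * m)%:R * (8 * q) by rewrite ler_wpM2l//; lra.
by move=> /le_lt_trans; apply; lra.
Unshelve. all: by end_near. Qed.
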